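(* Let $\mathcal{H}_1,\mathcal{H}_2$ be Hilbert spaces, let $\mathcal{S}\subseteq\mathcal{H}_1$ and $\mathcal{T}\subseteq\mathcal{H}_2$ be closed subspaces, and let $A\in L(\mathcal{H}_1,\mathcal{H}_2)$ be $(\mathcal{S},\mathcal{T})$-complementable. If $B\in L(\mathcal{H}_1,\mathcal{H}_2)$ satisfies $R(B)=\mathcal{T}$ and $R(B^* )=\mathcal{S}$, then there exists $n_0\in\mathbb{N}$ such that: 1. the pair $(A,nB)$ is parallel summable for every $n\geq n_0$; and 2. $A_{/(\mathcal{S},\mathcal{T})}=\lim_{n\to\infty}A:(nB)$ in the operator norm topology.
   Context: $L(\mathcal{H}_1,\mathcal{H}_2)$ is the space of bounded linear operators; $R(\cdot)$, $N(\cdot)$ denote range and nullspace; $|T|=(T^*T)^{1/2}$. Block form: for closed subspaces $\mathcal{S}\subseteq\mathcal{H}_1$, $\mathcal{T}\subseteq\mathcal{H}_2$, with $P_{\mathcal{M}}$ the orthogonal projection onto $\mathcal{M}$, write $A_{11}=P_{\mathcal{T}}A|_{\mathcal{S}}$, $A_{12}=P_{\mathcal{T}}A|_{\mathcal{S}^\perp}$, $A_{21}=P_{\mathcal{T}^\perp}A|_{\mathcal{S}}$, $A_{22}=P_{\mathcal{T}^\perp}A|_{\mathcal{S}^\perp}$. $A$ is $(\mathcal{S},\mathcal{T})$-complementable if $R(A_{21})\subseteq R(A_{22})$ and $R(A_{12}^* )\subseteq R(A_{22}^* )$. It is $(\mathcal{S},\mathcal{T})$-weakly complementable if $R(A_{21})\subseteq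 R(|A_{22}^*|^{1/2})$ and $R(A_{12}^* )\subseteq R(|A_{22}|^{1/2})$. Complementability implies weak complementability. Reduced solution: if $R(Y)\subseteq R(X)$, the reduced solution of $XD=Y$ is the unique bounded $D$ with $XD=Y$ and $R(D)\subseteq N(X)^\perp$. Bilateral shorted operator: for $A$ $(\mathcal{S},\mathcal{T})$-weakly complementable, let $A_{22}=U|A_{22}|$ be the polar decomposition, let $E\in L(\mathcal{S},\mathcal{S}^\perp)$ be the reduced solution of $A_{21}=|A_{22}^*|^{1/2}UX$ and $F\in L(\mathcal{T},\mathcal{S}^\perp)$ the reduced solution of $A_{12}^*=|A_{22}|^{1/2}X$. Then $A_{/(\mathcal{S},\mathcal{T})}$ is the operator with block form $\begin{pmatrix}A_{11}-F^*E&0\\ 0&0\end{pmatrix}$ relative to $\mathcal{S}\oplus\mathcal{S}^\perp$ and $\mathcal{T}\oplus\mathcal{T}^\perp$. Parallel summability: $A,B\in L(\mathcal{H}_1,\mathcal{H}_2)$ are parallel summable if $R(A)\subseteq R(A+B)$ and $R(A^* )\subseteq R(A^*+B^* )$. In that case the operator matrix $M=\begin{pmatrix}A&A\\ A&A+B\end{pmatrix}\in L(\mathcal{H}_1\oplus\mathcal{H}_1,\mathcal{H}_2\oplus\mathcal{H}_2)$ is $(\mathcal{H}_1\oplus\{0\},\mathcal{H}_2\oplus\{0\})$-complementable, and the parallel sum $A:B\in L(\mathcal{H}_1,\mathcal{H}_2)$ is defined by $\begin{pmatrix}A:B&0\\ 0&0\end{pmatrix}=M_{/(\mathcal{H}_1\oplus\{0\},\,\mathcal{H}_2\oplus\{0\})}$.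 *)

(* Defs.v *)
From HB Require Import structures.
From mathcomp Require Import all_boot all_order all_algebra.
From mathcomp Require Import complex.
From mathcomp Require Import boolp classical_sets functions reals topology normedtype.

Set Implicit Arguments.
Unset Strict Implicit.
Unset Printing Implicit Defensive.
Import Order.TTheory GRing.Theory Num.Theory.
Import numFieldNormedType.Exports.
Local Open Scope classical_set_scope.
Local Open Scope ring_scope.

Section DotNorm.
Variables (R : realType) (U : lmodType R[i]) (f : {dot U for Num.conj}).

Definition dotnorm (x : U) : R[i] := sqrtC (f x x).

Lemma dotnorm_eq0 x : dotnorm x = 0 -> x = 0.
Proof. by move/eqP; rewrite sqrtC_eq0 dnorm_eq0 => /eqP. Qed.

Lemma dotnormZ a x : dotnorm (a *: x) = `|a| * dotnorm x.
Proof.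
by rewrite /dotnorm dnormZ rootCMl ?exprn_ge0// sqrCK.
Qed.

Lemma dot_CauchySchwarz x y : `|f x y| <= dotnorm x * dotnorm y.
Proof.
have [->|y0] := eqVneq y 0.
  by rewrite linear0r normr0 mulr_ge0 ?sqrt_dnorm_ge0.
have fy : 0 < f y y by rewrite dnorm_gt0.
rewrite -ler_sqr ?nnegrE ?mulr_ge0 ?sqrt_dnorm_ge0// exprMn !sqrtCK.
pose a := f x y / f y y; pose z := x - a *: y.
have zy : f z y = 0.
  by rewrite linearBl/= linearZl_LR/= divfK ?subrr// gt_eqF.
have -> : x = z + a *: y by rewrite subrK.
rewrite linearDl/= zy add0r linearZl_LR/= normrM exprMn.
rewrite hnormDd/=; last by rewrite linearZr_LR/= zy mulr0.
rewrite dnormZ (ger0_norm (ltW fy)) mulrDl expr2 !mulrA.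
by rewrite lerDr mulr_ge0 ?dnorm_ge0// ltW.
Qed.

Lemma ler_dotnormD x y : dotnorm (x + y) <= dotnorm x + dotnorm y.
Proof.
rewrite -ler_sqr ?nnegrE ?addr_ge0 ?sqrt_dnorm_ge0// sqrrD !sqrtCK dnormD.
rewrite addrAC lerD2r lerD2l.
have fxy : f x y + (f x y)^* \is Num.real by rewrite CrealE rmorphD/= conjCK addrC.
apply: le_trans (real_ler_norm fxy) _.
apply: le_trans (ler_normD _ _) _.
by rewrite norm_conjC -mulr2n lerMn2r dot_CauchySchwarz.
Qed.

End DotNorm.

HB.mixin Record isHilbert (R : realType) H & CompleteNormedModule R[i] H := {
  inner : {dot H for Num.conj};
  normr_inner : forall x : H, `|x| = sqrtC (inner x x)
}.

#[short(type="hilbertType")]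
HB.structure Definition Hilbert (R : realType) :=
  {H of CompleteNormedModule R[i] H & isHilbert R H}.

Notation "'[ x , y ]" := (inner x y) : ring_scope.

Section InnerTheory.
Variables (R : realType) (H : hilbertType R).

Lemma inner_CauchySchwarz (x y : H) : `|'[x, y]| <= `|x| * `|y|.
Proof. by rewrite !normr_inner; exact: dot_CauchySchwarz. Qed.

Lemma inner_continuous (y : H) : continuous (fun x : H => '[x, y] : R[i]^o).
Proof.
move=> x; apply/cvgrPdist_lt => e e0.
have y1 : 0 < `|y| + 1 by rewrite ltr_wpDl.
near=> z.
rewrite -linearBl/= (le_lt_trans (inner_CauchySchwarz _ _))//.
rewrite (@le_lt_trans _ _ (`|x - z| * (`|y| + 1)))//.
  by rewrite ler_wpM2l// lerDl.
rewrite -ltr_pdivlMr//.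
by near: z; apply: cvgr_dist_lt; rewrite // divr_gt0.
Unshelve. all: by end_near. Qed.

End InnerTheory.

Record csubspace (R : realType) (H : hilbertType R) := CSubspace {
  csubspace_set :> set H;
  csubspace0 : csubspace_set 0;
  csubspaceP : forall (a : R[i]) x y,
    csubspace_set x -> csubspace_set y -> csubspace_set (a *: x + y);
  csubspace_closed : closed csubspace_set }.

Section Complement.
Variables (R : realType) (H : hilbertType R).

Definition orth (X : set H) : set H := [set x | forall y, X y -> '[x, y] = 0].

Lemma orth0 X : orth X 0.
Proof. by move=> y _; rewrite linear0l. Qed.

Lemma orthP X (a : R[i]) x y : orth X x -> orth X y -> orth X (a *: x + y).
Proof.
move=> ox oy z Xz.
by rewrite linearDl linearZl_LR/= ox// oy// mulr0 addr0.
Qed.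

Lemma orth_closed X : closed (orth X).
Proof.
have -> : orth X = \bigcap_(y in X) ((fun x : H => '[x, y]) @^-1` [set 0 : R[i]^o]).
  by apply/seteqP; split => x /= h y /h.
apply: closed_bigI => y _; apply: closed_comp.
  by move=> x _; exact: inner_continuous.
exact: (@accessible_closed_set1 _ (hausdorff_accessible (@norm_hausdorff _ _))).
Qed.

Definition ocompl (S : csubspace H) : csubspace H :=
  @CSubspace R H (orth S) (@orth0 S) (@orthP S) (@orth_closed S).

End Complement.
Notation "S ^⊥" := (ocompl S) (at level 2, format "S ^⊥").

Lemma cauchy_1lipschitz (K : numFieldType) (V W : normedModType K) (h : V -> W)
    (F : set_system V) : ProperFilter F ->
  (forall x y, `|h x - h y| <= `|x - y|) -> cauchy F -> cauchy (h @ F).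
Proof.
move=> FF hB /cauchyP Fc; apply/cauchyP => e e0; have [x Fx] := Fc e e0.
exists (h x); rewrite nbhs_simpl/=; apply: filterS Fx => y; rewrite -!ball_normE/=.
exact: le_lt_trans.
Qed.

Section SubspaceType.
Variables (R : realType) (H : hilbertType R) (S : csubspace H).

Definition csub_pred : {pred H} := [pred x | x \in (S : set H)].

Lemma csub_predP : submod_closed csub_pred.
Proof.
split=> [|a x y]; rewrite !inE; last exact: csubspaceP.
exact: csubspace0.
Qed.

HB.instance Definition _ :=
  GRing.isSubmodClosed.Build R[i] H csub_pred csub_predP.

Record csub := CSub { csub_val : H; csub_valP : csub_val \in csub_pred }.
HB.instance Definition _ := [isSub for csub_val].
HB.instance Definition _ := [Choice of csub by <:].
HB.instance Definition _ := [SubChoice_isSubLmodule of csub by <:].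

Definition csub_inner (x y : csub) : R[i] := '[val x, val y].

Let valP (a : R[i]) (x y : csub) : val (a *: x + y) = a *: val x + val y.
Proof. exact: linearP. Qed.

Lemma csub_inner_bilinear : bilinear_for *%R (Num.conj \; *%R) csub_inner.
Proof.
by split=> z a x y; rewrite /csub_inner valP ?linearPl// linearPr.
Qed.

HB.instance Definition _ := bilinear_isBilinear.Build
  R[i] csub csub R[i] *%R (Num.conj \; *%R) csub_inner csub_inner_bilinear.

Lemma csub_inner_herm x y :
  csub_inner x y = (-1) ^+ false * Num.conj (csub_inner y x).
Proof. exact: (hermC (inner : {dot H for Num.conj})). Qed.

HB.instance Definition _ := isHermitianSesquilinear.Build
  R[i] csub false Num.conj csub_inner csub_inner_herm.

Lemma csub_inner_gt0 x : x != 0 -> 0 < csub_inner x x.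
Proof. by move=> x0; apply: neq0_dnorm_gt0; rewrite -(inj_eq val_inj) in x0. Qed.

HB.instance Definition _ := isDotProduct.Build R[i] csub csub_inner csub_inner_gt0.

Let csub_dot : {dot csub for Num.conj} := csub_inner.

HB.instance Definition _ := Lmodule_isNormed.Build R[i] csub
  (ler_dotnormD csub_dot) (dotnormZ csub_dot) (@dotnorm_eq0 _ _ csub_dot).

Lemma csub_normE (x : csub) : `|x| = `|val x|.
Proof. by rewrite normr_inner. Qed.

Lemma csub_complete (F : set_system csub) : ProperFilter F -> cauchy F -> cvg F.
Proof.
move=> FF Fc; pose v (x : csub) : H := val x.
have vB x y : `|v x - v y| = `|x - y| by rewrite csub_normE /v raddfB.
have vFc : cauchy (v @ F) by apply: cauchy_1lipschitz Fc => x y; rewrite vB.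
have [l vl] := (cvg_ex _).1 (cauchy_cvg _ vFc).
have Sl : l \in csub_pred.
  rewrite inE; apply: (closed_cvg (S : set H) _ _ _ vl).
    exact: csubspace_closed.
  by apply: nearW => x; apply/set_mem; exact: csub_valP.
apply/cvg_ex; exists (CSub Sl); apply/cvgrPdist_lt => e e0.
move/cvgrPdist_lt : vl => /(_ e e0); apply: filterS => x /=.
by rewrite -vB.
Qed.

HB.instance Definition _ := Uniform_isComplete.Build csub csub_complete.
HB.instance Definition _ := isHilbert.Build R csub (fun x => erefl `|x|).

Lemma csub_innerE (x y : csub) : '[x, y] = '[val x, val y].
Proof. by []. Qed.

End SubspaceType.

(* H1 * H2 already carries the sup norm in the library, hence the alias *)
Definition dsum (R : realType) (H1 H2 : hilbertType R) : Type := (H1 * H2)%type.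
Notation "H1 ⊕ H2" := (dsum H1 H2) (at level 50, left associativity).

Section DirectSum.
Variables (R : realType) (H1 H2 : hilbertType R).

HB.instance Definition _ :=
  GRing.Lmodule.copy (H1 ⊕ H2) (H1 * H2)%type.

Definition dsum_inner (x y : H1 ⊕ H2) : R[i] := '[x.1, y.1] + '[x.2, y.2].

Lemma dsum_inner_bilinear : bilinear_for *%R (Num.conj \; *%R) dsum_inner.
Proof.
split=> z a x y; rewrite /dsum_inner/= ?linearPl ?linearPr/=;
by rewrite mulrDr addrACA.
Qed.

HB.instance Definition _ := bilinear_isBilinear.Build
  R[i] (H1 ⊕ H2) (H1 ⊕ H2) R[i] *%R (Num.conj \; *%R) dsum_inner
  dsum_inner_bilinear.

Lemma dsum_inner_herm x y :
  dsum_inner x y = (-1) ^+ false * Num.conj (dsum_inner y x).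
Proof.
by rewrite /dsum_inner mul1r rmorphD/= [in LHS]hermC mul1r; congr +%R;
  rewrite hermC mul1r.
Qed.

HB.instance Definition _ := isHermitianSesquilinear.Build
  R[i] (H1 ⊕ H2) false Num.conj dsum_inner dsum_inner_herm.

Lemma dsum_inner_gt0 x : x != 0 -> 0 < dsum_inner x x.
Proof.
case: x => x y xy0; rewrite /dsum_inner/=.
have [x0|x0] := eqVneq x 0; last by rewrite ltr_pwDl ?dnorm_gt0 ?dnorm_ge0.
rewrite ltr_wpDl ?dnorm_ge0 ?dnorm_gt0//.
by apply: contra xy0 => /eqP ->; rewrite x0.
Qed.

HB.instance Definition _ := isDotProduct.Build
  R[i] (H1 ⊕ H2) dsum_inner dsum_inner_gt0.

Let dsum_dot : {dot (H1 ⊕ H2) for Num.conj} := dsum_inner.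

HB.instance Definition _ := Lmodule_isNormed.Build R[i] (H1 ⊕ H2)
  (ler_dotnormD dsum_dot) (dotnormZ dsum_dot) (@dotnorm_eq0 _ _ dsum_dot).

Lemma dsum_norm_sqr (x : H1 ⊕ H2) : `|x| ^+ 2 = `|x.1| ^+ 2 + `|x.2| ^+ 2.
Proof.
have -> : `|x| = sqrtC (dsum_inner x x) by [].
by rewrite !normr_inner !sqrtCK.
Qed.

Lemma dsum_norm_fst (x : H1 ⊕ H2) : `|x.1| <= `|x|.
Proof.
by rewrite -ler_sqr ?nnegrE ?normr_ge0// dsum_norm_sqr lerDl exprn_ge0.
Qed.

Lemma dsum_norm_snd (x : H1 ⊕ H2) : `|x.2| <= `|x|.
Proof.
by rewrite -ler_sqr ?nnegrE ?normr_ge0// dsum_norm_sqr lerDr exprn_ge0.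
Qed.

Lemma dsum_norm_le (x : H1 ⊕ H2) : `|x| <= `|x.1| + `|x.2|.
Proof.
rewrite -ler_sqr ?nnegrE ?addr_ge0// dsum_norm_sqr sqrrD addrAC lerDl.
by rewrite mulrn_wge0 ?mulr_ge0.
Qed.

Lemma dsum_complete (F : set_system (H1 ⊕ H2)) :
  ProperFilter F -> cauchy F -> cvg F.
Proof.
move=> FF Fc.
pose p1 (x : H1 ⊕ H2) := x.1; pose p2 (x : H1 ⊕ H2) := x.2.
have F1 : cauchy (p1 @ F).
  by apply: cauchy_1lipschitz Fc => x y; exact: (dsum_norm_fst (x - y)).
have F2 : cauchy (p2 @ F).
  by apply: cauchy_1lipschitz Fc => x y; exact: (dsum_norm_snd (x - y)).
have [l1 l1P] := (cvg_ex _).1 (cauchy_cvg _ F1).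
have [l2 l2P] := (cvg_ex _).1 (cauchy_cvg _ F2).
apply/cvg_ex; exists ((l1, l2) : H1 ⊕ H2).
apply/cvgrPdist_lt => e e0; have e20 : 0 < e / 2 by rewrite divr_gt0.
near=> x; rewrite (le_lt_trans (dsum_norm_le _))//= [e]splitr ltrD//.
  by near: x; move/cvgrPdist_lt : l1P; exact.
by near: x; move/cvgrPdist_lt : l2P; exact.
Unshelve. all: by end_near. Qed.

HB.instance Definition _ := Uniform_isComplete.Build (H1 ⊕ H2) dsum_complete.
HB.instance Definition _ := isHilbert.Build R (H1 ⊕ H2) (fun x => erefl `|x|).

Lemma dsum_innerE (x y : H1 ⊕ H2) : '[x, y] = '[x.1, y.1] + '[x.2, y.2].
Proof. by []. Qed.

Definition dsum_fst_set : set (H1 ⊕ H2) := [set x | x.2 = 0].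

Lemma dsum_fstP (a : R[i]) (x y : H1 ⊕ H2) :
  dsum_fst_set x -> dsum_fst_set y -> dsum_fst_set (a *: x + y).
Proof. by rewrite /dsum_fst_set/= => -> ->; rewrite scaler0 addr0. Qed.

Lemma dsum_snd_continuous : continuous (fun x : H1 ⊕ H2 => x.2).
Proof.
move=> x; apply/(@cvgrPdist_lt _ _ _ (nbhs x)) => e e0.
have xe : nbhs x (ball x e) by exact: nbhsx_ballx.
apply: filterS xe => y; rewrite -ball_normE; exact: le_lt_trans (dsum_norm_snd (x - y)).
Qed.

Lemma dsum_fst_closed : closed dsum_fst_set.
Proof.
apply: (@closed_comp _ _ (fun x : H1 ⊕ H2 => x.2) [set 0]).
  by move=> x _; exact: dsum_snd_continuous.
exact: (@accessible_closed_set1 _ (hausdorff_accessible (@norm_hausdorff _ _))).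
Qed.

(* the closed subspace H1 ⊕ {0} *)
Definition dsum_fst : csubspace (H1 ⊕ H2) :=
  @CSubspace R (H1 ⊕ H2) dsum_fst_set erefl dsum_fstP dsum_fst_closed.

End DirectSum.

Record bop (R : realType) (H1 H2 : hilbertType R) := BOp {
  bop_fun :> H1 -> H2;
  bop_linear : linear bop_fun;
  bop_bounded : exists M : R, forall x, `|bop_fun x| <= M%:C%C * `|x| }.
Notation "''L' ( H1 , H2 )" := (bop H1 H2)
  (at level 8, format "''L' ( H1 ,  H2 )").

Section BopTheory.
Variables (R : realType) (H1 H2 : hilbertType R).
Implicit Types A B C : 'L(H1, H2).

HB.instance Definition _ A := GRing.isLinear.Build _ _ _ _ A (@bop_linear _ _ _ A).

Lemma bopP A B : A =1 B -> A = B.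
Proof.
case: A B => [f fl fb] [g gl gb] /= /funext fg.
by subst g; congr BOp; exact: Prop_irrelevance.
Qed.

Lemma bop_boundP A : exists2 M : R, 0 <= M & forall x, `|A x| <= M%:C%C * `|x|.
Proof.
have [M MP] := bop_bounded A; exists `|M| => // x.
apply: le_trans (MP x) _; rewrite ler_wpM2r// lecR; exact: ler_norm.
Qed.

Lemma bop0_subproof :
  linear (fun _ : H1 => 0 : H2) /\
  exists M : R, forall x : H1, `|0 : H2| <= M%:C%C * `|x|.
Proof.
split; first by move=> a x y; rewrite scaler0 addr0.
by exists 0 => x; rewrite normr0 mul0r.
Qed.
Definition bop0 : 'L(H1, H2) := BOp bop0_subproof.1 bop0_subproof.2.

Lemma bop_add_subproof A B :
  linear (fun x => A x + B x) /\
  exists M : R, forall x, `|A x + B x| <= M%:C%C * `|x|.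
Proof.
split; first by move=> a x y; rewrite !linearP scalerDr addrACA.
have [M M0 MP] := bop_boundP A; have [N N0 NP] := bop_boundP B.
exists (M + N) => x; rewrite rmorphD/= mulrDl.
by apply: le_trans (ler_normD _ _) _; exact: lerD.
Qed.
Definition bop_add A B : 'L(H1, H2) :=
  BOp (bop_add_subproof A B).1 (bop_add_subproof A B).2.

Lemma bop_scale_subproof (a : R[i]) A :
  linear (fun x => a *: A x) /\
  exists M : R, forall x, `|a *: A x| <= M%:C%C * `|x|.
Proof.
split; first by move=> b x y; rewrite linearP scalerDr !scalerA mulrC.
have [M M0 MP] := bop_boundP A; exists (complex.Re `|a| * M) => x.
by rewrite normrZ rmorphM/= -mulrA ler_pM//.
Qed.
Definition bop_scale (a : R[i]) A : 'L(H1, H2) :=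
  BOp (bop_scale_subproof a A).1 (bop_scale_subproof a A).2.

Definition bop_opp A : 'L(H1, H2) := bop_scale (- 1) A.

HB.instance Definition _ := gen_eqMixin 'L(H1, H2).
HB.instance Definition _ := gen_choiceMixin 'L(H1, H2).

Let bop_addA : associative bop_add.
Proof. by move=> A B C; apply: bopP => x; exact: addrA. Qed.
Let bop_addC : commutative bop_add.
Proof. by move=> A B; apply: bopP => x; exact: addrC. Qed.
Let bop_add0 : left_id bop0 bop_add.
Proof. by move=> A; apply: bopP => x; exact: add0r. Qed.
Let bop_addN : left_inverse bop0 bop_opp bop_add.
Proof. by move=> A; apply: bopP => x; rewrite /= scaleN1r addNr. Qed.

HB.instance Definition _ := GRing.isZmodule.Build 'L(H1, H2)
  bop_addA bop_addC bop_add0 bop_addN.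

Let bop_scaleA a b A : bop_scale a (bop_scale b A) = bop_scale (a * b) A.
Proof. by apply: bopP => x; exact: scalerA. Qed.
Let bop_scale1 : left_id 1 bop_scale.
Proof. by move=> A; apply: bopP => x; exact: scale1r. Qed.
Let bop_scaleDr : right_distributive bop_scale +%R.
Proof. by move=> a A B; apply: bopP => x; exact: scalerDr. Qed.
Let bop_scaleDl A : {morph bop_scale^~ A : a b / a + b}.
Proof. by move=> a b; apply: bopP => x; exact: scalerDl. Qed.

HB.instance Definition _ := GRing.Zmodule_isLmodule.Build R[i] 'L(H1, H2)
  bop_scaleA bop_scale1 bop_scaleDr bop_scaleDl.

(* real-valued, whereas the norm of H1 and H2 takes its values in R[i] *)
Definition opnorm A : R :=
  sup [set complex.Re `|A x| | x in [set x : H1 | `|x| <= 1]].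

Definition nullspace A : set H1 := [set x | A x = 0].

End BopTheory.

Section Composition.
Variables (R : realType) (H1 H2 H3 : hilbertType R).

Lemma bop_comp_subproof (A : 'L(H2, H3)) (B : 'L(H1, H2)) :
  linear (fun x => A (B x)) /\
  exists M : R, forall x, `|A (B x)| <= M%:C%C * `|x|.
Proof.
split; first by move=> a x y; rewrite !linearP.
have [M M0 MP] := bop_boundP A; have [N N0 NP] := bop_boundP B.
exists (M * N) => x; apply: le_trans (MP _) _.
by rewrite rmorphM/= -mulrA ler_wpM2l// lecR.
Qed.
Definition bop_comp (A : 'L(H2, H3)) (B : 'L(H1, H2)) : 'L(H1, H3) :=
  BOp (bop_comp_subproof A B).1 (bop_comp_subproof A B).2.

End Composition.
Notation "A ∘ B" := (bop_comp A B) (at level 40, left associativity).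

(* The operators below are characterised by a property which, under the stated
   hypotheses, exactly one bounded operator satisfies; [xget 0] selects it (and
   is 0 when there is none). *)

Section Operators.
Variables (R : realType).
Implicit Types H K : hilbertType R.

Definition adjoint H K (A : 'L(H, K)) : 'L(K, H) :=
  xget 0 [set B : 'L(K, H) | forall x y, '[A x, y] = '[x, B y]].

(* over the complex numbers, a positive operator is automatically selfadjoint *)
Definition positive_op H (A : 'L(H, H)) := forall x, 0 <= '[A x, x].

Definition sqrt_op H (A : 'L(H, H)) : 'L(H, H) :=
  xget 0 [set Q : 'L(H, H) | positive_op Q /\ Q ∘ Q = A].

Definition abs_op H K (A : 'L(H, K)) : 'L(H, H) := sqrt_op (adjoint A ∘ A).

(* the partial isometry U of the polar decomposition A = U |A| *)
Definition polar_op H K (A : 'L(H, K)) : 'L(H, K) :=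
  xget 0 [set U : 'L(H, K) | [/\ A = U ∘ abs_op A, nullspace U = nullspace A &
    forall x, orth (nullspace U) x -> `|U x| = `|x|]].

(* reduced solution of X D = Y *)
Definition reduced_solution H K G (X : 'L(K, G)) (Y : 'L(H, G)) : 'L(H, K) :=
  xget 0 [set D : 'L(H, K) |
    X ∘ D = Y /\ range D `<=` orth (nullspace X)].

Lemma inclusion_subproof H (S : csubspace H) :
  linear (fun x : csub S => val x) /\
  exists M : R, forall x : csub S, `|val x| <= M%:C%C * `|x|.
Proof.
split; first by move=> a x y; exact: linearP.
by exists 1 => x; rewrite csub_normE mul1r.
Qed.
Definition inclusion H (S : csubspace H) : 'L(csub S, H) :=
  BOp (inclusion_subproof S).1 (inclusion_subproof S).2.

(* the orthogonal projection onto S, with values in S *)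
Definition projection H (S : csubspace H) : 'L(H, csub S) :=
  xget 0 [set P : 'L(H, csub S) | forall x, orth S (x - val (P x))].

End Operators.

(* P_T A|_S *)
Definition block (R : realType) (H1 H2 : hilbertType R) (S : csubspace H1)
    (T : csubspace H2) (A : 'L(H1, H2)) : 'L(csub S, csub T) :=
  projection T ∘ A ∘ inclusion S.

Section Shorted.
Variables (R : realType) (H1 H2 : hilbertType R).
Variables (S : csubspace H1) (T : csubspace H2) (A : 'L(H1, H2)).

Let A11 := block S T A.
Let A12 := block S^⊥ T A.
Let A21 := block S T^⊥ A.
Let A22 := block S^⊥ T^⊥ A.

Definition complementable :=
  range A21 `<=` range A22 /\ range (adjoint A12) `<=` range (adjoint A22).

Definition weakly_complementable :=
  range A21 `<=` range (sqrt_op (abs_op (adjoint A22))) /\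
  range (adjoint A12) `<=` range (sqrt_op (abs_op A22)).

(* the operator with block form (C11, 0; 0, 0) with respect to S ⊕ S^⊥ and
   T ⊕ T^⊥ *)
Definition corner (C11 : 'L(csub S, csub T)) : 'L(H1, H2) :=
  inclusion T ∘ C11 ∘ projection S.

Definition shorted : 'L(H1, H2) :=
  let E := reduced_solution
    (sqrt_op (abs_op (adjoint A22)) ∘ polar_op A22) A21 in
  let F := reduced_solution (sqrt_op (abs_op A22)) (adjoint A12) in
  corner (A11 - adjoint F ∘ E).

End Shorted.

Section ParallelSum.
Variables (R : realType) (H1 H2 : hilbertType R).
Implicit Types A B C D : 'L(H1, H2).

Lemma opmatrix_subproof A B C D :
  let f (x : H1 ⊕ H1) : H2 ⊕ H2 := (A x.1 + B x.2, C x.1 + D x.2) in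
  linear f /\ exists M : R, forall x, `|f x| <= M%:C%C * `|x|.
Proof.
split=> [a x y|].
  by congr pair; rewrite /= !linearP/= scalerDr addrACA.
have bnd (X Y : 'L(H1, H2)) : exists2 M : R, 0 <= M &
    forall x : H1 ⊕ H1, `|X x.1 + Y x.2| <= M%:C%C * `|x|.
  have [M M0 MP] := bop_boundP X; have [N N0 NP] := bop_boundP Y.
  exists (M + N) => [|x]; first by rewrite addr_ge0.
  rewrite rmorphD/= mulrDl; apply: le_trans (ler_normD _ _) _.
  apply: lerD; [apply: le_trans (MP _) _|apply: le_trans (NP _) _].
    by rewrite ler_wpM2l ?lecR// dsum_norm_fst.
  by rewrite ler_wpM2l ?lecR// dsum_norm_snd.
have [M M0 MP] := bnd A B; have [N N0 NP] := bnd C D.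
exists (M + N) => x; rewrite rmorphD/= mulrDl.
by apply: le_trans (dsum_norm_le _) _; exact: lerD (MP x) (NP x).
Qed.

(* the operator matrix (A, B; C, D) *)
Definition opmatrix A B C D : 'L(H1 ⊕ H1, H2 ⊕ H2) :=
  BOp (opmatrix_subproof A B C D).1 (opmatrix_subproof A B C D).2.

Definition parallel_summable A B :=
  range A `<=` range (A + B) /\
  range (adjoint A) `<=` range (adjoint A + adjoint B).

Definition parallel_sum A B : 'L(H1, H2) :=
  xget 0 [set C | opmatrix C 0 0 0 =
    shorted (dsum_fst H1 H1) (dsum_fst H2 H2) (opmatrix A A A (A + B))].

End ParallelSum.

(* Main.v *)
(* Write K for the shorted operator of A. For complementable A, K x = A (s - y),
   where s is the projection of x on S and y is any vector orthogonal to S such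
   that A (s - y) lies in T. Likewise A : B maps x to A (x - y) for any y with
   (A + B) y = A x.
   Since B is bounded below from S onto T, K + nB maps onto T for large n, with a
   right inverse of norm O(1/n). If (K + nB) k = K x, then adding to k suitable
   vectors orthogonal to S, on which B vanishes, gives y with
   (A + nB) y = A x and A (x - y) = K x - K k. Hence the range of A is contained
   in that of A + nB, and A : nB differs from K by x |-> - K k, whose norm is
   O(1/n). The other range inclusion is the same statement for the adjoints. *)
Require Import Defs.
From mathcomp Require Import all_boot all_order all_algebra.
From mathcomp Require Import complex ring lra.
From mathcomp Require Import boolp classical_sets functions reals topology normedtype.

Set Implicit Arguments.
Unset Strict Implicit.
Unset Printing Implicit Defensive.
Import Order.TTheory GRing.Theory Num.Theory.
Import numFieldNormedType.Exports.
Local Open Scope classical_set_scope.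
Local Open Scope ring_scope.

(** The operators of the definitions are selected by [xget 0], so each is the default 0 until a
    witness is produced. Projections, adjoints and reduced solutions all come from one variational
    lemma, [bounded_functional_rep]: a functional dominated by |X v| is the pairing with a vector in
    the closure of the range of X. Square roots come from an iteration, and polar parts from reduced
    solutions. The shorted operator is defined through |A22|^(1/2) and the polar part of A22; for
    complementable A these cancel and leave A11 - A12 X0, with X0 the reduced solution of A22 X =
    A21. The analytic input is uniform boundedness, which turns a range inclusion into a norm
    inequality between adjoints. Applied to B, it bounds the adjoint of B from below on T.
    Solvability of (K + nB) k = K x is then a matter of duality: for large n the adjoint of K + nB
    is still bounded below on T, and k represents a functional. *)

Lemma gt0_real_complex (R : realType) (e : R[i]) :
  0 < e -> exists2 r : R, 0 < r & e = r%:C%C.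
Proof.
move=> e0; exists (complex.Re e); last by rewrite RRe_real ?gtr0_real.
by move: e0; rewrite ltcE => /andP[].
Qed.

Lemma natr_real_complex (R : realType) n : n%:R = (n%:R)%:C%C :> R[i].
Proof. by rewrite rmorph_nat. Qed.

(** * Hilbert spaces and their operators *)

Section RealNorm.
Variables (R : realType) (H : hilbertType R).
Implicit Types x y z : H.

Definition nrm x : R := complex.Re `|x|.

Lemma nrmE x : `|x| = (nrm x)%:C%C.
Proof. by rewrite RRe_real ?normr_real. Qed.

Lemma nrm_ge0 x : 0 <= nrm x.
Proof. by rewrite -lecR -nrmE normr_ge0. Qed.

Lemma nrm_eq0 x : nrm x = 0 -> x = 0.
Proof. by move=> x0; apply/normr0_eq0; rewrite nrmE x0. Qed.

Lemma nrm0 : nrm 0 = 0.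
Proof. by rewrite /nrm normr0. Qed.

Lemma nrmD x y : nrm (x + y) <= nrm x + nrm y.
Proof. by rewrite -lecR rmorphD/= -!nrmE ler_normD. Qed.

Lemma nrmN x : nrm (- x) = nrm x.
Proof. by rewrite /nrm normrN. Qed.

Lemma nrmB x y : nrm (x - y) = nrm (y - x).
Proof. by rewrite -nrmN opprB. Qed.

Lemma nrm_dist x y z : nrm (x - z) <= nrm (x - y) + nrm (y - z).
Proof. by rewrite -{1}(subrK y x) -addrA nrmD. Qed.

Lemma Re_norm_ge0 (a : R[i]) : 0 <= complex.Re `|a|.
Proof. by rewrite -lecR RRe_real ?normr_real ?normr_ge0. Qed.

Lemma nrmZC (a : R[i]) x : nrm (a *: x) = complex.Re `|a| * nrm x.
Proof.
by apply: complexI; rewrite -nrmE normrZ nrmE -{1}(RRe_real (normr_real a)) rmorphM.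
Qed.

Lemma nrmZ (r : R) x : nrm (r%:C%C *: x) = `|r| * nrm x.
Proof. by rewrite nrmZC normc_def /= expr0n addr0 sqrtr_sqr. Qed.

Definition rin x y : R := complex.Re '[x, y].

Lemma inner_nrm x : '[x, x] = ((nrm x) ^+ 2)%:C%C.
Proof. by rewrite rmorphXn/= -nrmE normr_inner sqrtCK. Qed.

Lemma rin_nrm x : rin x x = nrm x ^+ 2.
Proof. by rewrite /rin inner_nrm. Qed.

Lemma innerC x y : '[x, y] = ('[y, x])^*.
Proof. by rewrite [LHS](hermC inner) mul1r. Qed.

Lemma rinC x y : rin x y = rin y x.
Proof. by rewrite /rin innerC; case: '[y, x]. Qed.

Lemma rinDl x y z : rin (x + y) z = rin x z + rin y z.
Proof. by rewrite /rin linearDl/=; case: '[x, z]; case: '[y, z]. Qed.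

Lemma rinNl x y : rin (- x) y = - rin x y.
Proof. by rewrite /rin linearNl/=; case: '[x, y]. Qed.

Lemma rinDr x y z : rin x (y + z) = rin x y + rin x z.
Proof. by rewrite rinC rinDl !(rinC x). Qed.

Lemma rinNr x y : rin x (- y) = - rin x y.
Proof. by rewrite rinC rinNl rinC. Qed.

Lemma rinZl (r : R) x y : rin (r%:C%C *: x) y = r * rin x y.
Proof. by rewrite /rin linearZl_LR/=; case: '[x, y] => a b /=; rewrite mul0r subr0. Qed.

Lemma rinZr (r : R) x y : rin x (r%:C%C *: y) = r * rin x y.
Proof. by rewrite rinC rinZl rinC. Qed.

Lemma rin_ler x y : rin x y <= nrm x * nrm y.
Proof.
rewrite -lecR rmorphM/= -!nrmE; apply: le_trans (inner_CauchySchwarz x y).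
apply: le_trans (normc_ge_Re _); rewrite lecR ler_norm //.
Qed.

Lemma nrmD2 x y : nrm (x + y) ^+ 2 = nrm x ^+ 2 + nrm y ^+ 2 + rin x y *+ 2.
Proof. by rewrite -!rin_nrm rinDl !rinDr (rinC y x) mulr2n; ring. Qed.

Lemma inner_nrm_le x y : `|'[x, y]| <= (nrm x * nrm y)%:C%C.
Proof. by rewrite rmorphM/= -!nrmE inner_CauchySchwarz. Qed.

Lemma eq_inner x y : (forall z, '[z, x] = '[z, y]) -> x = y.
Proof.
move=> xy; apply/eqP; rewrite -subr_eq0 -normr_eq0 nrmE.
have := inner_nrm (x - y); rewrite {1}linearBr/= xy subrr => /eqP.
by rewrite eq_sym -!(rmorph0 (real_complex R)) !(inj_eq (@complexI _)) sqrf_eq0.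
Qed.

Lemma hilbert_cvg (u : nat -> H) :
  (forall e : R, 0 < e -> exists N, forall n, (N <= n)%N -> nrm (u n - u N) < e) ->
  exists l, forall e : R, 0 < e -> exists N, forall n, (N <= n)%N -> nrm (l - u n) < e.
Proof.
move=> uc; have : cvg (u @ \oo).
  apply: cauchy_cvg; apply: cauchy_exP => _ /gt0_real_complex[e e0 ->].
  have [N uN] := uc e e0; exists (u N), N => // n /= Nn.
  by rewrite -ball_normE /= distrC nrmE ltcR uN.
move=> /cvg_ex[l /cvgrPdist_lt ul]; exists l => e e0.
have [|N _ uN] := ul e%:C%C; first by rewrite ltcR.
by exists N => n Nn; rewrite -ltcR -nrmE; exact: uN.
Qed.

Lemma closure_nrmP (X : set H) l :
  closure X l <-> forall e : R, 0 < e -> exists2 x, X x & nrm (l - x) < e.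
Proof.
split=> [Xl e e0|Xl B /nbhs_ballP[_ /= /gt0_real_complex[e e0 ->] eB]].
  have [|x [Xx]] := Xl (ball l e%:C%C); first by apply: nbhsx_ballx; rewrite ltcR.
  by rewrite -ball_normE /= nrmE ltcR => lx; exists x.
have [x Xx lx] := Xl e e0; exists x; split=> //; apply: eB.
by rewrite -ball_normE /= nrmE ltcR.
Qed.

End RealNorm.

(** Limit arguments below collect their errors as e times a fixed factor; leaving c arbitrary spares
    a normalisation of e. *)
Lemma ler_addgt0M (R : realFieldType) (a b c : R) :
  (forall e, 0 < e -> a <= b + e * c) -> a <= b.
Proof.
move=> h; rewrite leNgt; apply/negP => ba.
have [c0|c0] := leP c 0; first by have := h 1 ltr01; lra.
have := h ((a - b) / (2 * c)); rewrite divr_gt0 ?mulr_gt0 ?subr_gt0// => /(_ isT).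
have -> : (a - b) / (2 * c) * c = (a - b) / 2 by field; rewrite gt_eqF.
lra.
Qed.

(** * Representation of functionals by minimisation *)

Section BoundedFunctional.
Variables (R : realType) (V : lmodType R[i]) (K : hilbertType R).
Variables (X : V -> K) (phi : V -> R[i]) (c : R).
Hypothesis XP : forall a v w, X (a *: v + w) = a *: X v + X w.
Hypothesis phiP : forall a v w, phi (a *: v + w) = a * phi v + phi w.
Hypothesis c0 : 0 <= c.
Hypothesis phi_le : forall v, `|phi v| <= (c * nrm (X v))%:C%C.

Let f v : R := complex.Re (phi v).
(** If k represents phi, then J v = |X v - k|^2 - |k|^2, so minimising J drives X v towards k
    without mentioning k. *)
Let J v : R := nrm (X v) ^+ 2 - f v *+ 2.

Let fE (r : R) v w : f (r%:C%C *: v + w) = r * f v + f w.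
Proof. by rewrite /f phiP; case: (phi v) (phi w) => a b [a' b'] /=; rewrite mul0r subr0. Qed.

Let XE (r : R) v w : X (r%:C%C *: v + w) = r%:C%C *: X v + X w.
Proof. exact: XP. Qed.

Let X0 : X 0 = 0.
Proof. by have := XP 1 0 0; rewrite !scale1r addr0 -{1}[X 0]addr0 => /addrI. Qed.

Let f_le v : f v <= c * nrm (X v).
Proof.
rewrite -lecR; apply: le_trans (phi_le v); apply: le_trans (normc_ge_Re _).
by rewrite lecR ler_norm.
Qed.

Let m := inf (range J).

Let J_ge v : m <= J v.
Proof.
apply: ge_inf; last by exists v.
exists (- c ^+ 2) => _ [w _ <-]; rewrite /J.
by have := f_le w; have := sqr_ge0 (nrm (X w) - c); nra.
Qed.

Let J_min (e : R) : 0 < e -> exists v, J v < m + e.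
Proof.
move=> e0; have [|_ [v _ <-] Jv] := @inf_adherent _ (range J) e e0.
  split; first by exists (J 0), 0.
  by exists m => _ [w _ <-]; exact: J_ge.
by exists v.
Qed.

(** J at the midpoint of v and w equals (J v + J w) / 2 - |X v - X w|^2 / 4 and is at least m. *)
Let J_parallelogram v w :
  nrm (X v - X w) ^+ 2 <= (J v - m + (J w - m)) *+ 2.
Proof.
have := J_ge (2^-1%:C%C *: v + (2^-1%:C%C *: w + 0)).
rewrite /J !fE !XE -!rin_nrm X0 addr0.
rewrite !(rinDl, rinDr, rinNl, rinNr, rinZl, rinZr) (rinC (X w) (X v)).
have -> : f 0 = 0.
  by have := fE 1 0 0; rewrite scaler0 addr0 mul1r -{1}[f 0]addr0 => /addrI.
lra.
Qed.

(** A near-minimiser nearly satisfies the Euler equation: w is moved along v by t = a / (b + 1). The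
    optimal t would be a / b; the added 1 covers X v = 0. *)
Let J_variation v w (e : R) : J w < m + e ->
  `|f v - rin (X v) (X w)| ^+ 2 <= (nrm (X v) ^+ 2 + 1) ^+ 2 * e.
Proof.
move=> Jw; rewrite real_normK ?num_real//; set a := f v - _; set b := nrm (X v) ^+ 2.
have b0 : 0 <= b by exact: sqr_ge0.
have b1 : b + 1 != 0 by rewrite gt_eqF// ltr_wpDl.
have := J_ge ((a / (b + 1))%:C%C *: v + w); set t := a / (b + 1).
have -> : J (t%:C%C *: v + w) = J w + t ^+ 2 * b - (t * a) *+ 2.
  rewrite /J fE XE -!rin_nrm !(rinDl, rinDr, rinZl, rinZr) (rinC (X w) (X v)).
  by rewrite /a /b -rin_nrm; ring.
move=> mJ; have {mJ} : t ^+ 2 * (b + 1 + 1) <= e.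
  have -> : t ^+ 2 * (b + 1 + 1) = (t * a) *+ 2 - t ^+ 2 * b by rewrite /t; field.
  by rewrite mulr2n; lra.
move=> te; have -> : a ^+ 2 = (b + 1) ^+ 2 * t ^+ 2 by rewrite /t; field.
rewrite ler_wpM2l ?sqr_ge0//; apply: le_trans te.
by rewrite ler_peMr ?sqr_ge0// lerDr addr_ge0.
Qed.

(* phi is represented by the limit of X v along a minimising sequence of
   |X v|^2 - 2 Re (phi v). *)
Lemma bounded_functional_rep : exists k : K,
  [/\ closure (range X) k, forall v, phi v = '[X v, k] & nrm k <= c].
Proof.
have /choice[u uJ] : forall n : nat, exists v, J v < m + n.+1%:R^-1.
  by move=> n; apply: J_min; rewrite invr_gt0.
have small (e : R) : 0 < e -> exists N : nat, forall n, (N <= n)%N -> J (u n) < m + e.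
  move=> e0; exists (Num.truncn e^-1) => n Nn; apply: lt_le_trans (uJ n) _.
  rewrite lerD2l -[e]invrK lef_pV2 ?posrE ?invr_gt0//.
  by apply/ltW/(lt_le_trans (truncnS_gt _)); rewrite ler_nat.
have [|k uk] := @hilbert_cvg _ _ (X \o u).
  (* Two excesses below e^2 / 5 bound the squared distance by 4 e^2 / 5 in [J_parallelogram]. *)
  move=> e e0; have [|N uN] := small (e ^+ 2 / 5); first by rewrite divr_gt0 ?exprn_gt0.
  exists N => n Nn /=; rewrite -(@ltr_pXn2r _ 2) ?nnegrE ?nrm_ge0 ?ltW//.
  have := J_parallelogram (u n) (u N); have := uN n Nn; have := uN N (leqnn _).
  have : 0 < e ^+ 2 by rewrite exprn_gt0.
  lra.
have Xk : closure (range X) k.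
  apply/closure_nrmP => e e0; have [N uN] := uk e e0.
  by exists (X (u N)); [exists (u N)|exact: uN].
have fk v : f v = rin (X v) k.
  apply/eqP; rewrite -subr_eq0 -normr_eq0 eq_le normr_ge0 andbT.
  apply: (@ler_addgt0M _ _ _ (nrm (X v) ^+ 2 + 1 + nrm (X v))) => e e0.
  have [N1 uN1] := small (e ^+ 2) (exprn_gt0 _ e0); have [N2 uN2] := uk e e0.
  pose n := maxn N1 N2.
  have := J_variation v (uN1 n (leq_maxl _ _)).
  have b0 : 0 <= nrm (X v) ^+ 2 + 1 by rewrite addr_ge0 ?sqr_ge0.
  rewrite -exprMn ler_pXn2r ?nnegrE ?normr_ge0 ?mulr_ge0// ?(ltW e0)// => h1.
  have h2 : `|rin (X v) (X (u n) - k)| <= nrm (X v) * e.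
    have ke : nrm (k - X (u n)) <= e by apply/ltW/uN2; exact: leq_maxr.
    rewrite ler_norml -lerN2 opprK -rinNr opprB; apply/andP; split.
      by apply: le_trans (rin_ler _ _) _; rewrite ler_wpM2l ?nrm_ge0.
    by apply: le_trans (rin_ler _ _) _; rewrite ler_wpM2l ?nrm_ge0// nrmB.
  rewrite add0r.
  have -> : f v - rin (X v) k = f v - rin (X v) (X (u n)) + rin (X v) (X (u n) - k).
    by rewrite rinDr rinNr; ring.
  by apply: le_trans (ler_normD _ _) _; rewrite mulrDr lerD// mulrC.
exists k; split=> // [v|].
  have phiZ a : phi (a *: v) = a * phi v.
    have phi0 : phi 0 = 0.
      by have := phiP 1 0 0; rewrite scaler0 addr0 mul1r -{1}[phi 0]addr0 => /addrI.
    by rewrite -[a *: v]addr0 phiP phi0 addr0.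
  have XZ a : X (a *: v) = a *: X v by rewrite -[a *: v]addr0 XP X0 addr0.
  (* [fk] compares real parts only; evaluating it at i v yields the imaginary parts. *)
  have := fk v; have := fk ('i%C *: v); rewrite /f phiZ /rin XZ linearZl_LR/=.
  case: (phi v) => p q; case: '[_, _] => p' q' /=; rewrite !mul0r !mul1r !sub0r.
  by move=> /oppr_inj -> ->.
have [->//|k0] := eqVneq (nrm k) 0.
have {}k0 : 0 < nrm k by rewrite lt0r k0 nrm_ge0.
(* With X v within e of k, |k|^2 = f v + Re <k - X v, k> is at most c (|k| + e) + e |k|; let e tend
   to 0 and divide by |k|. *)
rewrite -(ler_pM2r k0) -expr2; apply: (@ler_addgt0M _ _ _ (c + nrm k)) => e e0.
have /closure_nrmP/(_ e e0)[_ [v _ <-] kv] := Xk.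
have -> : nrm k ^+ 2 = f v + rin (k - X v) k.
  by rewrite fk -rinDl addrC subrK rin_nrm.
have h1 := rin_ler (k - X v) k; have h2 := f_le v.
have h3 : nrm (X v) <= nrm k + e.
  by have := nrmD (X v - k) k; rewrite subrK nrmB; lra.
have : c * nrm (X v) <= c * (nrm k + e) by rewrite ler_wpM2l.
have : nrm (k - X v) * nrm k <= e * nrm k by rewrite ler_wpM2r ?nrm_ge0// ltW.
lra.
Qed.

End BoundedFunctional.

Section Bop.
Variables (R : realType) (H K : hilbertType R).
Implicit Types A B : 'L(H, K).

Lemma bop_nrm A : exists2 M : R, 0 <= M & forall x, nrm (A x) <= M * nrm x.
Proof.
have [M M0 AM] := bop_boundP A; exists M => // x.
by rewrite -lecR rmorphM/= -!nrmE AM.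
Qed.

(** Projections, adjoints, reduced solutions and strong limits are found one vector at a time;
    uniqueness of the value is what makes the chosen function linear. *)
Lemma bop_of_rel (r : H -> K -> Prop) (c : R) :
  (forall x, exists2 y, r x y & nrm y <= c * nrm x) ->
  (forall x y y', r x y -> r x y' -> y = y') ->
  (forall a x x' y y', r x y -> r x' y' -> r (a *: x + x') (a *: y + y')) ->
  exists2 A : 'L(H, K), (forall x, r x (A x)) & forall x, nrm (A x) <= c * nrm x.
Proof.
move=> ex uniq lin.
have /choice[f fP] x : exists y, r x y /\ nrm y <= c * nrm x.
  by have [y xy yc] := ex x; exists y.
have fl : linear f.
  move=> a x y; apply: uniq (fP _).1 _.
  by apply: lin; [exact: (fP x).1|exact: (fP y).1].
have fb : exists M : R, forall x, `|f x| <= M%:C%C * `|x|.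
  by exists c => x; rewrite !nrmE -rmorphM lecR (fP x).2.
by exists (BOp fl fb) => x; case: (fP x).
Qed.

Lemma bopD A B x : (A + B) x = A x + B x. Proof. by []. Qed.
Lemma bopZ a A x : (a *: A) x = a *: A x. Proof. by []. Qed.
Lemma bopN A x : (- A) x = - A x. Proof. exact: scaleN1r. Qed.
Lemma bopB A B x : (A - B) x = A x - B x. Proof. by rewrite bopD bopN. Qed.
Lemma bop0E x : (0 : 'L(H, K)) x = 0. Proof. by []. Qed.

Lemma orth_closure (X : set H) y :
  (forall x, X x -> '[x, y] = 0) -> forall x, closure X x -> '[x, y] = 0.
Proof.
move=> Xy x /closure_nrmP Xx.
apply/eqP; rewrite -normr_eq0 eq_le normr_ge0 andbT.
have -> : `|'[x, y]| = (complex.Re `|'[x, y]|)%:C%C by rewrite RRe_real ?normr_real.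
rewrite lecR; apply: (@ler_addgt0M _ _ _ (nrm y)) => e e0.
have [z Xz xz] := Xx e e0; rewrite add0r.
have -> : '[x, y] = '[x - z, y] by rewrite linearBl/= (Xy z Xz) subr0.
rewrite -lecR RRe_real ?normr_real//; apply: le_trans (inner_nrm_le _ _) _.
by rewrite lecR ler_wpM2r ?nrm_ge0// ltW.
Qed.

End Bop.

(** * Orthogonal projections and adjoints *)

Section Projection.
Variables (R : realType) (H : hilbertType R) (S : csubspace H).
Implicit Types x y : H.

Lemma orthC x y : '[x, y] = 0 -> '[y, x] = 0.
Proof. by move=> xy; rewrite innerC xy conjC0. Qed.

Lemma csubspaceB x y : csubspace_set S x -> csubspace_set S y -> csubspace_set S (x - y).
Proof. by move=> Sx Sy; rewrite addrC -scaleN1r; exact: csubspaceP. Qed.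

Lemma csubspaceD x y : csubspace_set S x -> csubspace_set S y -> csubspace_set S (x + y).
Proof. by move=> Sx Sy; rewrite -[x]scale1r; exact: csubspaceP. Qed.

Lemma csubspaceZ a x : csubspace_set S x -> csubspace_set S (a *: x).
Proof. by move=> Sx; rewrite -[a *: x]addr0; apply: csubspaceP => //; exact: csubspace0. Qed.

Lemma orth_disjoint (X : set H) x : X x -> orth X x -> x = 0.
Proof.
move=> Xx /(_ x Xx); rewrite inner_nrm -(rmorph0 (real_complex R)).
by move/complexI/eqP; rewrite sqrf_eq0 => /eqP/nrm_eq0.
Qed.

Definition csub_of x (Sx : csubspace_set S x) : csub S :=
  CSub (mem_set Sx : x \in csub_pred S).

Lemma csub_in (s : csub S) : csubspace_set S (val s).
Proof. by apply: set_mem; exact: (csub_valP s). Qed.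

Lemma csub_val_linear a (s s' : csub S) : val (a *: s + s') = a *: val s + val s'.
Proof. exact: linearP. Qed.

(** The projection of x represents the functional s -> <s, x> on S. The representing vector lies in
    the closure of S, hence in S, and is no longer than x. *)
Lemma projection_subproof : exists P : 'L(H, csub S),
  forall x, orth S (x - val (P x)).
Proof.
have [|x s s' xs xs'|a x x' s s' xs xs'|P Px _] :=
    @bop_of_rel _ H (csub S) (fun x s => orth S (x - val s)) 1.
- move=> x; have [a v w|a v w|s|k [Sk kP kx]] := @bounded_functional_rep _ (csub S) H
      (fun s => val s) (fun s => '[val s, x]) (nrm x) _ _ (nrm_ge0 x).
  + exact: csub_val_linear.
  + by rewrite csub_val_linear linearDl linearZl_LR.
  + by rewrite mulrC; exact: inner_nrm_le.
  have {}Sk : csubspace_set S k.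
    have -> : S = closure S :> set H by apply/closure_id; exact: csubspace_closed.
    by apply: closure_subset Sk => _ [s _ <-]; exact: csub_in.
  exists (csub_of Sk); last by rewrite mul1r /nrm csub_normE.
  move=> y Sy; apply: orthC; rewrite linearBr/=.
  by rewrite -(kP (csub_of Sy)) subrr.
- apply: val_inj; apply/eqP; rewrite -subr_eq0; apply/eqP; apply: (@orth_disjoint S).
    by apply: csubspaceB; exact: csub_in.
  move=> y Sy; have -> : val s - val s' = (x - val s') - (x - val s).
    by rewrite opprB [RHS]addrC addrA subrK.
  by rewrite linearBl/= xs// xs'// subrr.
- have -> : a *: x + x' - val (a *: s + s') = a *: (x - val s) + (x' - val s').
    by rewrite csub_val_linear scalerBr opprD addrACA.
  exact: orthP.
- by exists P.
Qed.

Definition proj x : H := val (projection S x).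

Lemma proj_orth x : orth S (x - proj x).
Proof.
rewrite /proj /projection; case: xgetP => [P _|/(_ _)]; first exact.
by have [P PP] := projection_subproof => /(_ P).
Qed.

Lemma proj_in x : csubspace_set S (proj x). Proof. exact: csub_in. Qed.

Lemma proj_uniq x s : csubspace_set S s -> orth S (x - s) -> proj x = s.
Proof.
move=> Ss xs; apply/eqP; rewrite -subr_eq0; apply/eqP; apply: (@orth_disjoint S).
  by apply: csubspaceB => //; exact: proj_in.
have -> : proj x - s = (x - s) - (x - proj x) by rewrite opprB [RHS]addrC addrA subrK.
by move=> y Sy; rewrite linearBl/= xs// proj_orth// subrr.
Qed.

Lemma proj_id x : csubspace_set S x -> proj x = x.
Proof. by move=> Sx; apply: proj_uniq; rewrite // subrr; exact: orth0. Qed.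

Lemma proj_eq0 x : orth S x -> proj x = 0.
Proof. by move=> Sx; apply: proj_uniq; rewrite ?subr0//; exact: csubspace0. Qed.

Lemma proj_linear a x y : proj (a *: x + y) = a *: proj x + proj y.
Proof. by rewrite /proj linearP csub_val_linear. Qed.

Lemma orthK x : orth (S^⊥ : set H) x -> csubspace_set S x.
Proof.
move=> Sx; have -> : x = proj x; last exact: proj_in.
apply/eqP; rewrite -subr_eq0; apply/eqP; apply: (@orth_disjoint (orth S)).
  exact: proj_orth.
move=> y Sy; rewrite linearBl/= Sx// [X in _ - X]orthC ?subrr//.
by apply: Sy; exact: proj_in.
Qed.

End Projection.

Section Adjoint.
Variables (R : realType) (H K : hilbertType R).
Implicit Types A B : 'L(H, K).

(** Riesz representation of x -> <A x, y>, with X the identity in [bounded_functional_rep]. *)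
Lemma adjoint_subproof A : exists B : 'L(K, H), forall x y, '[A x, y] = '[x, B y].
Proof.
have [M M0 AM] := bop_nrm A.
have [|y z z' yz yz'|a y y' z z' yz yz'|B BP _] :=
    @bop_of_rel _ K H (fun y z => forall x, '[A x, y] = '[x, z]) M.
- move=> y; have [a v w|a v w||v|z [_ zP zy]] := @bounded_functional_rep _ H H idfun
      (fun x => '[A x, y]) (M * nrm y).
  + by [].
  + by rewrite linearP linearDl linearZl_LR.
  + by rewrite mulr_ge0 ?nrm_ge0.
  + apply: le_trans (inner_nrm_le _ _) _; rewrite lecR mulrAC.
    by rewrite ler_wpM2r ?nrm_ge0.
  by exists z.
- by apply: eq_inner => x; rewrite -yz -yz'.
- by move=> x; rewrite !linearDr !linearZr_LR/= yz yz'.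
- by exists B.
Qed.

Lemma adjointP A x y : '[A x, y] = '[x, adjoint A y].
Proof.
rewrite /adjoint; case: xgetP => [B _|/(_ _)]; first exact.
by have [B BP] := adjoint_subproof A => /(_ B).
Qed.

Lemma adjoint_uniq A (B : 'L(K, H)) : (forall x y, '[A x, y] = '[x, B y]) -> adjoint A = B.
Proof.
by move=> AB; apply: bopP => y; apply: eq_inner => x; rewrite -adjointP AB.
Qed.

End Adjoint.

Lemma bop_compE (R : realType) (H K G : hilbertType R) (B : 'L(K, G)) (A : 'L(H, K)) x :
  (B ∘ A) x = B (A x).
Proof. by []. Qed.

Section AdjointTheory.
Variables (R : realType) (H K G : hilbertType R).

Lemma inner_adjointl (A : 'L(H, K)) x y : '[adjoint A x, y] = '[x, A y].
Proof. by rewrite innerC -adjointP -innerC. Qed.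

Lemma adjointK (A : 'L(H, K)) : adjoint (adjoint A) = A.
Proof. by apply: adjoint_uniq => x y; rewrite inner_adjointl. Qed.

Lemma adjoint_comp (A : 'L(H, K)) (B : 'L(K, G)) :
  adjoint (B ∘ A) = adjoint A ∘ adjoint B.
Proof. by apply: adjoint_uniq => x y; rewrite /= !adjointP. Qed.

Lemma adjointD (A B : 'L(H, K)) : adjoint (A + B) = adjoint A + adjoint B.
Proof. by apply: adjoint_uniq => x y; rewrite linearDl linearDr/= !adjointP. Qed.

Lemma adjointZ (a : R[i]) (A : 'L(H, K)) : adjoint (a *: A) = a^* *: adjoint A.
Proof.
by apply: adjoint_uniq => x y; rewrite linearZl_LR linearZr_LR/= adjointP conjCK.
Qed.

Lemma closure_rangeP (A : 'L(H, K)) (a : R[i]) x y :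
  closure (range A) x -> closure (range A) y -> closure (range A) (a *: x + y).
Proof.
move=> /closure_nrmP Ax /closure_nrmP Ay; apply/closure_nrmP => e e0.
have a0 := Re_norm_ge0 a.
have [|_ [u _ <-] xu] := Ax (e / 2 / (complex.Re `|a| + 1)).
  by rewrite !divr_gt0// ltr_wpDl.
have [|_ [v _ <-] yv] := Ay (e / 2); first by rewrite divr_gt0.
exists (A (a *: u + v)); first by exists (a *: u + v).
have -> : a *: x + y - A (a *: u + v) = a *: (x - A u) + (y - A v).
  by rewrite linearP scalerBr opprD addrACA.
apply: le_lt_trans (nrmD _ _) _.
rewrite [e](splitr e) ler_ltD//.
rewrite nrmZC.
have := xu; rewrite ltr_pdivlMr ?ltr_wpDl// => xu'.
by apply/ltW/(le_lt_trans _ xu'); rewrite mulrC ler_wpM2l ?nrm_ge0// lerDl.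
Qed.

(** Ranges need not be closed, and one can project only onto the closure. Projecting onto
    [closure_range (adjoint A)] splits a vector into its parts orthogonal to and inside the
    nullspace of A. *)
Definition closure_range (A : 'L(H, K)) : csubspace K.
Proof.
refine (@CSubspace _ _ (closure (range A)) _ (@closure_rangeP A) (@closed_closure _ (range A))).
by apply: subset_closure; exists 0; rewrite ?linear0.
Defined.

Lemma inner_self_eq0 (x : H) : '[x, x] = 0 -> x = 0.
Proof. by move=> xx; apply: (@orth_disjoint _ _ [set x]) => // y ->. Qed.

End AdjointTheory.

Section OrthNullspace.
Variables (R : realType) (H K : hilbertType R) (A : 'L(H, K)).

Lemma orth_range_adjoint z : (forall y, '[adjoint A y, z] = 0) -> A z = 0.
Proof.
by move=> Az; apply: inner_self_eq0; rewrite adjointP; apply: orthC.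
Qed.

(** The part z of x orthogonal to the closure is killed by A, hence orthogonal to x; being also
    orthogonal to the projection of x, it is orthogonal to itself. *)
Lemma orth_nullspace_closure x :
  orth (nullspace A) x -> closure (range (adjoint A)) x.
Proof.
move=> Ax; pose C := closure_range (adjoint A); pose z := x - proj C x.
have Cz : orth C z by exact: proj_orth.
have Az : A z = 0.
  apply: orth_range_adjoint => y; apply: orthC; apply: Cz.
  by apply: subset_closure; exists y.
have -> : x = proj C x; last exact: (proj_in C x).
apply/eqP; rewrite -subr_eq0; apply/eqP; apply: inner_self_eq0.
by rewrite {1}linearBl/= (Ax z Az) [X in _ - X]orthC ?subrr//; apply: Cz; exact: proj_in.
Qed.

End OrthNullspace.

Lemma rin_adjoint (R : realType) (H K : hilbertType R) (A : 'L(H, K)) x y :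
  rin (A x) y = rin x (adjoint A y).
Proof. by rewrite /rin adjointP. Qed.

(** * Uniform boundedness by a gliding sequence *)

Section UniformBoundedness.
Variables (R : realType) (H : hilbertType R).
Implicit Types u : nat -> H.

(** The increments after stage n add up to at most [a n], and they are small once [a] is close to
    its infimum, whatever that infimum is. *)
Lemma telescope_cvg u (a : nat -> R) :
  (forall n, 0 <= a n) -> (forall n, nrm (u n.+1 - u n) <= a n - a n.+1) ->
  exists2 l, forall n, nrm (l - u n) <= a n &
    forall e : R, 0 < e -> exists N, forall n, (N <= n)%N -> nrm (l - u n) < e.
Proof.
move=> a0 ua.
have uD n k : nrm (u (k + n)%N - u n) <= a n - a (k + n)%N.
  elim: k => [|k IH]; first by rewrite !add0n !subrr nrm0.
  apply: le_trans (nrm_dist _ (u (k + n)%N) _) _; rewrite addSn.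
  by have := ua (k + n)%N; lra.
have uM n m : (n <= m)%N -> nrm (u m - u n) <= a n - a m.
  by move=> nm; rewrite -(subnK nm); exact: uD.
have [|l ul] := @hilbert_cvg _ _ u.
  move=> e e0; have [|_ [N _ <-] aN] := @inf_adherent _ (range a) e e0.
    by split; [exists (a 0%N), 0%N|exists 0 => _ [n _ <-]].
  exists N => n Nn; apply: le_lt_trans (uM _ _ Nn) _.
  rewrite ltrBlDr; apply: lt_le_trans aN _; rewrite addrC lerD2l.
  by apply: ge_inf; [exists 0 => _ [k _ <-]|exists n].
exists l => // n; apply: (@ler_addgt0M _ _ _ 1) => e e0.
have [N uN] := ul e e0; have lN := uN _ (leq_maxl N n).
apply: le_trans (nrm_dist _ (u (maxn N n)) _) _.
have := uM n _ (leq_maxr N n); have := a0 (maxn N n); lra.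
Qed.

(* Sokal's argument: among x + w and x - w with w a multiple of v i, one has a
   pairing with v i at least as large as that of w; steps of size 3^-n along
   ever longer v i converge to a point with unbounded pairings. *)
Lemma uniform_boundedness (I : Type) (v : I -> H) :
  (forall h, exists M, forall i, `|rin h (v i)| <= M) ->
  exists M, forall i, nrm (v i) <= M.
Proof.
move=> vb; apply: contrapT => nb.
pose p n : R := 3^-1 ^+ n.
have p0 n : 0 < p n by rewrite exprn_gt0 ?invr_gt0 ?ltr0n.
have /choice[i iP] : forall n, exists i, n%:R *+ 2 < p n * nrm (v i).
  move=> n; apply: contrapT => ni; apply: nb; exists (n%:R *+ 2 / p n) => i.
  rewrite ler_pdivlMr// leNgt; apply/negP => h; apply: ni; exists i.
  by rewrite mulrC.
have /choice[f fP] (nx : nat * H) : exists y, nrm (y - nx.2) <= p nx.1 /\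
    p nx.1 * nrm (v (i nx.1)) <= `|rin y (v (i nx.1))|.
  case: nx => n x /=; set w := v (i n).
  have w0 : 0 < nrm w.
    by rewrite -(pmulr_rgt0 _ (p0 n)); apply: le_lt_trans (iP n); rewrite mulrn_wge0.
  pose t := p n / nrm w; have t0 : 0 < t by rewrite divr_gt0.
  have tw : t * nrm w = p n by rewrite divfK// gt_eqF.
  have nw : nrm (t%:C%C *: w) = p n by rewrite nrmZ gtr0_norm.
  have rw : rin (t%:C%C *: w) w = p n * nrm w.
    by rewrite rinZl rin_nrm expr2 mulrA tw.
  have [h|h] := leP (p n * nrm w) `|rin (x + t%:C%C *: w) w|.
    by exists (x + t%:C%C *: w); rewrite addrAC subrr add0r nw.
  exists (x - t%:C%C *: w); rewrite addrAC subrr add0r nrmN nw; split=> //.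
  move: h; rewrite !rinDl rinNl rw ltr_norml => /andP[h1 h2].
  by rewrite ler_normr; apply/orP; right; lra.
pose fix u n := if n is m.+1 then f (m, u m) else 0.
(* 3/2 * 3^-n is the sum of all steps of size 3^-k with k >= n, so the limit stays that close to
   [u n]. *)
have [n|n|l lu _] := @telescope_cvg u (fun n => p n * (3 / 2)).
- by have := p0 n; lra.
- apply: le_trans (fP (n, u n)).1 _; rewrite /= /p exprS.
  by have := p0 n; rewrite /p; lra.
have [M lM] := vb l; have := lM (i (Num.truncn M).+1).
set n := (Num.truncn M).+1; apply/negP; rewrite -ltNge.
have Mn : M < n%:R by exact: truncnS_gt.
have h1 := (fP (n, u n)).2; have h2 := lu n.+1; have h3 := iP n; rewrite /= in h1 h2.
have pS : p n.+1 = p n / 3 by rewrite /p exprSr.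
set w := v (i n) in h1 h3 *; rewrite pS in h2.
(* The limit l is within p n / 2 of the next iterate, which costs at most half of the pairing p n *
   nrm w. The other half exceeds n > M, thanks to the factor 2 in [iP]. *)
have h4 : `|rin (f (n, u n) - l) w| <= p n / 2 * nrm w.
  have e : nrm (l - f (n, u n)) <= p n / 2 by lra.
  rewrite ler_norml -lerN2 opprK -rinNl opprB; apply/andP; split;
    apply: le_trans (rin_ler _ _) _; rewrite ler_wpM2r ?nrm_ge0//.
  by rewrite nrmB.
have : `|rin (f (n, u n)) w| <= `|rin (f (n, u n) - l) w| + `|rin l w|.
  by rewrite -{1}(subrK l (f (n, u n))) rinDl ler_normD.
rewrite mulr2n in h3; lra.
Qed.

End UniformBoundedness.

(** * Range inclusion, majorization and reduced solutions *)

Section Douglas.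
Variables (R : realType) (H K G : hilbertType R).
Variables (X : 'L(K, G)) (Y : 'L(H, G)).

(* The vectors Y^* g with |X^* g| <= 1 are weakly bounded, since
   <Y h, g> = <d, X^* g> whenever Y h = X d. *)
Lemma range_subset_majorized : range Y `<=` range X ->
  exists2 c, 0 <= c & forall g, nrm (adjoint Y g) <= c * nrm (adjoint X g).
Proof.
move=> YX; pose I := {g | nrm (adjoint X g) <= 1}.
have [h|M MP] := @uniform_boundedness _ _ I (fun g => adjoint Y (sval g)).
  have [d _ dE] : range X (Y h) by apply: YX; exists h.
  exists (nrm d) => -[g /= g1]; rewrite -rin_adjoint -dE rin_adjoint.
  have dg : nrm d * nrm (adjoint X g) <= nrm d by rewrite ler_piMr ?nrm_ge0.
  rewrite ler_norml -lerN2 opprK -rinNl; apply/andP; split;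
    apply: le_trans (rin_ler _ _) _ => //.
  by rewrite nrmN.
have M0 : 0 <= M.
  have i0 : nrm (adjoint X 0) <= 1 by rewrite linear0 nrm0.
  by apply: le_trans (MP (exist _ 0 i0)); exact: nrm_ge0.
exists M => // g; apply: (@ler_addgt0M _ _ _ M) => e e0.
have pe : 0 < nrm (adjoint X g) + e by rewrite ltr_wpDl ?nrm_ge0.
(* The added e keeps the normalisation meaningful when [adjoint X g] is 0. *)
pose t := (nrm (adjoint X g) + e)^-1; have t0 : 0 < t by rewrite invr_gt0.
have i1 : nrm (adjoint X (t%:C%C *: g)) <= 1.
  by rewrite linearZ nrmZ gtr0_norm// mulrC ler_pdivrMr// mul1r lerDl ltW.
have := MP (exist _ (t%:C%C *: g) i1 : I); rewrite /= linearZ nrmZ gtr0_norm//.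
by rewrite mulrC ler_pdivrMr//; lra.
Qed.

Definition is_reduced_solution (D : 'L(H, K)) :=
  X ∘ D = Y /\ range D `<=` orth (nullspace X).

(** D h represents g -> <Y^* g, h> through X^*. It lies in the closure of the range of X^*, hence is
    orthogonal to the nullspace of X. Stated from the inequality, it also serves the polar
    decomposition, where the norms are compared directly. *)
Lemma majorized_reduced_solution (c : R) : 0 <= c ->
  (forall g, nrm (adjoint Y g) <= c * nrm (adjoint X g)) ->
  exists D, is_reduced_solution D.
Proof.
move=> c0 YX.
have [|h k k' [kX ko] [kX' ko']|a h h' k k' [kX ko] [kX' ko']|D DP _] := @bop_of_rel _ H K
    (fun h k => X k = Y h /\ orth (nullspace X) k) c.
- move=> h; have [a v w|a v w||g|k [kX kE kh]] := @bounded_functional_rep _ G K (adjoint X)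
    (fun g => '[adjoint Y g, h]) (c * nrm h).
  + exact: linearP.
  + by rewrite linearP linearDl linearZl_LR.
  + by rewrite mulr_ge0 ?nrm_ge0.
  + apply: le_trans (inner_nrm_le _ _) _; rewrite lecR mulrAC.
    by rewrite ler_wpM2r ?nrm_ge0.
  exists k => //; split.
    by apply: eq_inner => g; rewrite -!inner_adjointl kE.
  move=> z Xz; apply: orth_closure kX => _ [g _ <-].
  by rewrite inner_adjointl Xz linear0r.
- apply/eqP; rewrite -subr_eq0; apply/eqP.
  apply: (@orth_disjoint _ _ (nullspace X)); first by rewrite /nullspace/= linearB/= kX kX' subrr.
  by move=> z Xz; rewrite linearBl/= ko// ko'// subrr.
- by rewrite !linearP/= kX kX'; split=> //; exact: orthP.
exists D; split; first by apply: bopP => h; exact: (DP h).1.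
by move=> _ [h _ <-]; exact: (DP h).2.
Qed.

Lemma is_reduced_solution_uniq D D' :
  is_reduced_solution D -> is_reduced_solution D' -> D = D'.
Proof.
move=> [DX Do] [DX' Do']; apply: bopP => h; apply/eqP; rewrite -subr_eq0; apply/eqP.
apply: (@orth_disjoint _ _ (nullspace X)).
  by rewrite /nullspace/= linearB/= -!bop_compE DX DX' subrr.
have {}Do := Do _ (ex_intro2 _ _ h I erefl); have {}Do' := Do' _ (ex_intro2 _ _ h I erefl).
by move=> z Xz; rewrite linearBl/= Do// Do'// subrr.
Qed.

Lemma reduced_solutionE D : is_reduced_solution D -> reduced_solution X Y = D.
Proof.
move=> DP; apply: is_reduced_solution_uniq (DP).
by rewrite /reduced_solution; case: xgetP => [? _//|/(_ D)].
Qed.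

Lemma range_subset_reduced_solution : range Y `<=` range X ->
  exists D, is_reduced_solution D.
Proof. by move=> /range_subset_majorized[c c0]; exact: majorized_reduced_solution. Qed.

End Douglas.

Lemma rin_adjoint_uniq (R : realType) (H K : hilbertType R) (A : 'L(H, K)) (B : 'L(K, H)) :
  (forall x y, rin (A x) y = rin x (B y)) -> adjoint A = B.
Proof.
move=> AB; apply: adjoint_uniq => x y.
have := AB x y; have := AB ('i%C *: x) y; rewrite /rin linearZ/= !linearZl_LR/=.
case: '[A x, y] => a b; case: '[x, B y] => a' b' /=; rewrite !mul0r !mul1r !sub0r.
by move=> /oppr_inj -> ->.
Qed.

(** * Square roots and the polar decomposition *)

Section Limits.
Variables (R : realType) (H K : hilbertType R).

Definition tends (u : nat -> H) l :=
  forall e : R, 0 < e -> exists N, forall n, (N <= n)%N -> nrm (l - u n) < e.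

Lemma tends_le u l (v : nat -> R) c :
  (forall n, nrm (l - u n) <= c * v n) ->
  (forall e : R, 0 < e -> exists N, forall n, (N <= n)%N -> v n < e) -> 0 <= c ->
  tends u l.
Proof.
move=> uv v0 c0 e e0; have [|N vN] := v0 (e / (c + 1)); first by rewrite divr_gt0// ltr_wpDl.
exists N => n Nn; apply: le_lt_trans (uv n) _.
have := vN n Nn; rewrite ltr_pdivlMr ?ltr_wpDl// => h.
have [v0n|v0n] := leP 0 (v n); first by apply: le_lt_trans h; rewrite mulrC ler_wpM2l// lerDl.
by apply: le_lt_trans e0; rewrite mulr_ge0_le0// ltW.
Qed.

Lemma tends_uniq u l l' : tends u l -> tends u l' -> l = l'.
Proof.
move=> ul ul'; apply/eqP; rewrite -subr_eq0; apply/eqP/nrm_eq0.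
apply/eqP; rewrite eq_le nrm_ge0 andbT; apply: (@ler_addgt0M _ _ _ 2) => e e0.
have [N uN] := ul e e0; have [N' uN'] := ul' e e0.
have := uN _ (leq_maxl N N'); have := uN' _ (leq_maxr N N').
by have := nrm_dist l (u (maxn N N')) l'; rewrite (nrmB (u _) l'); lra.
Qed.

Lemma tends_add u v l k : tends u l -> tends v k -> tends (fun n => u n + v n) (l + k).
Proof.
move=> ul vk e e0.
have [|N uN] := ul (e / 2); first by rewrite divr_gt0.
have [|N' vN] := vk (e / 2); first by rewrite divr_gt0.
exists (maxn N N') => n; rewrite geq_max => /andP[nN nN'].
rewrite opprD addrACA; apply: le_lt_trans (nrmD _ _) _.
by have := uN n nN; have := vN n nN'; lra.
Qed.

Lemma tends_scale a u l : tends u l -> tends (fun n => a *: u n) (a *: l).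
Proof.
move=> ul; apply: (@tends_le _ _ (fun n => nrm (l - u n)) (complex.Re `|a|)).
- by move=> n; rewrite -scalerBr nrmZC.
- exact: ul.
- exact: Re_norm_ge0.
Qed.

Lemma tends_shift u l : tends u l -> tends (fun n => u n.+1) l.
Proof. by move=> ul e /ul[N uN]; exists N => n Nn; apply/uN/leqW. Qed.

Lemma tends_cst l : tends (fun=> l) l.
Proof. by move=> e e0; exists 0%N => n _; rewrite subrr nrm0. Qed.

End Limits.

Lemma tends_bop (R : realType) (H K : hilbertType R) (A : 'L(H, K)) u l :
  tends u l -> tends (fun n => A (u n)) (A l).
Proof.
move=> ul; have [M M0 AM] := bop_nrm A.
apply: (@tends_le _ _ _ _ (fun n => nrm (l - u n)) M) => //.
by move=> n; have := AM (l - u n); rewrite linearB.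
Qed.

(** * Positive operators and their square roots *)

Section Positive.
Variables (R : realType) (H : hilbertType R).
Implicit Types T P Q : 'L(H, H).

(** The defect d is sesquilinear and vanishes on the diagonal, since <T u, u> is real. At u + v this
    gives antisymmetry, which together with the diagonal value at x + i y forces d = 0. *)
Lemma positive_selfadjoint T : positive_op T -> adjoint T = T.
Proof.
move=> Tp; apply: adjoint_uniq => x y.
pose d u v := '[T u, v] - '[u, T v].
have dd u : d u u = 0.
  by rewrite /d (innerC u) conj_Creal ?ger0_real// subrr.
have dDl u v w : d (u + v) w = d u w + d v w.
  by rewrite /d (linearD T)/= !linearDl/= opprD addrACA.
have dDr u v w : d w (u + v) = d w u + d w v.
  by rewrite /d (linearD T)/= !linearDr/= opprD addrACA.
have dZl a u v : d (a *: u) v = a * d u v.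
  by rewrite /d (linearZ_LR T)/= !linearZl_LR/= mulrBr.
have dZr a u v : d u (a *: v) = a^* * d u v.
  by rewrite /d (linearZ_LR T)/= !linearZr_LR/= mulrBr.
have dN u v : d v u = - d u v.
  apply/eqP; rewrite -addr_eq0; have := dd (u + v).
  by rewrite dDl !dDr !dd add0r addr0 addrC => ->.
have := dd (x + 'i *: y); rewrite dDl !dDr !dZl !dZr !dd dN conjCi !mulr0 add0r addr0.
rewrite mulrNN -mulr2n => /eqP; rewrite mulrn_eq0/= mulf_eq0 (negbTE (neq0Ci _))/= => /eqP yx.
by apply/eqP; rewrite -subr_eq0 -/(d x y) dN yx oppr0.
Qed.

Lemma selfadjoint_rin T x y : adjoint T = T -> rin (T x) y = rin x (T y).
Proof. by rewrite rin_adjoint => ->. Qed.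

Lemma positive_rin T x : positive_op T -> 0 <= rin (T x) x.
Proof. by move=> /(_ x); rewrite lecE => /andP[]. Qed.

Lemma rin_positive T : adjoint T = T -> (forall x, 0 <= rin (T x) x) -> positive_op T.
Proof.
move=> TT Tp x; suff -> : '[T x, x] = (rin (T x) x)%:C%C by rewrite lecR.
by rewrite RRe_real// CrealE -innerC adjointP TT.
Qed.

(** Positivity of T is tested at M x - T x; the term <T T x, T x> that appears is at most M |T
    x|^2. *)
Lemma positive_nrm T (M : R) x : positive_op T -> 0 < M ->
  (forall y, nrm (T y) <= M * nrm y) -> nrm (T x) ^+ 2 <= M * rin (T x) x.
Proof.
move=> Tp M0 TM; have TT := positive_selfadjoint Tp.
have := positive_rin (M%:C%C *: x - T x) Tp.
rewrite linearB linearZ/= !rinDl !rinDr !rinNl !rinNr !rinZl !rinZr.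
rewrite (selfadjoint_rin (T x) x TT) rin_nrm.
have h := rin_ler (T (T x)) (T x).
have : nrm (T (T x)) * nrm (T x) <= M * nrm (T x) ^+ 2.
  by rewrite expr2 mulrA ler_wpM2r ?nrm_ge0.
move=> h1 h2; rewrite -(ler_pM2l M0); lra.
Qed.

Lemma positive_eq0 T x : positive_op T -> rin (T x) x = 0 -> T x = 0.
Proof.
move=> Tp Tx; have [M M0 TM] := bop_nrm T; apply: nrm_eq0.
have M1 : 0 < M + 1 by rewrite ltr_wpDl.
have := @positive_nrm T (M + 1) x Tp M1 _; rewrite Tx mulr0 => h.
apply/eqP; rewrite -sqrf_eq0 eq_le sqr_ge0 andbT; apply: h => y.
by apply: le_trans (TM y) _; rewrite ler_wpM2r ?nrm_ge0// lerDl.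
Qed.

End Positive.

Section SquareRoot.
Variables (R : realType) (H : hilbertType R).
Implicit Types T P Q C : 'L(H, H).

Lemma bop_id_subproof :
  linear (fun x : H => x) /\ exists M : R, forall x : H, `|x| <= M%:C%C * `|x|.
Proof. by split=> //; exists 1 => x; rewrite mul1r. Qed.

Definition bop_id : 'L(H, H) := BOp bop_id_subproof.1 bop_id_subproof.2.

Section Contraction.
Variable T : 'L(H, H).
Hypotheses (Tpos : positive_op T) (T1 : forall x, nrm (T x) <= nrm x).

Let Z := bop_id - T.

(* Visser's iteration X := (1 - T + X^2) / 2 converges to 1 - sqrt T; the same
   iteration started from scalars, with 1 - T replaced by 1, dominates it. *)
Fixpoint sqrt_iter n : 'L(H, H) :=
  if n is m.+1 then 2^-1%:C%C *: (Z + sqrt_iter m ∘ sqrt_iter m) else 0.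

Fixpoint sqrt_bound n : R :=
  if n is m.+1 then (1 + sqrt_bound m ^+ 2) / 2 else 0.

Let ZE x : Z x = x - T x. Proof. by rewrite /Z bopB. Qed.

Let Z1 x : nrm (Z x) <= nrm x.
Proof.
have TT := positive_selfadjoint Tpos.
rewrite -(@ler_pXn2r _ 2) ?nnegrE ?nrm_ge0// ZE -!rin_nrm !rinDl !rinDr !rinNl !rinNr.
rewrite -(selfadjoint_rin x x TT).
have := @positive_nrm _ _ T 1 x Tpos ltr01; rewrite mul1r -!rin_nrm => h.
have {}h := h (fun y => _); have : rin (T x) (T x) <= rin (T x) x.
  by apply: h => y; rewrite mul1r.
by move=> h0; have := positive_rin x Tpos; lra.
Qed.

Lemma sqrt_iterS n x :
  sqrt_iter n.+1 x = 2^-1%:C%C *: (Z x + sqrt_iter n (sqrt_iter n x)).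
Proof. by []. Qed.

Lemma sqrt_bound01 n : 0 <= sqrt_bound n <= 1.
Proof. by elim: n => [|n /andP[h1 h2]] /=; [rewrite lexx ler01|apply/andP; split; nra]. Qed.

Lemma norm_half : `|2^-1 : R| = 2^-1.
Proof. by rewrite ger0_norm// invr_ge0. Qed.

Lemma sqrt_iter_le n x : nrm (sqrt_iter n x) <= sqrt_bound n * nrm x.
Proof.
elim: n x => [|n IH] x; first by rewrite nrm0 mul0r.
have /andP[b0 b1] := sqrt_bound01 n.
rewrite sqrt_iterS nrmZ norm_half.
have h1 := nrmD (Z x) (sqrt_iter n (sqrt_iter n x)); have h2 := Z1 x.
have h3 := IH (sqrt_iter n x); have := ler_wpM2l b0 (IH x).
by rewrite /= => h4; lra.
Qed.

(** A A - B B = A (A - B) + (A - B) B is dominated termwise by a^2 - b^2 = a (a - b) + (a - b) b, so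
    the scalar increments keep majorising the operator increments. *)
Lemma sqrt_iter_dist n x :
  nrm (sqrt_iter n.+1 x - sqrt_iter n x) <= (sqrt_bound n.+1 - sqrt_bound n) * nrm x.
Proof.
elim: n x => [|n IH] x.
  rewrite sqrt_iterS /= addr0 subr0 nrmZ norm_half.
  by have := Z1 x; rewrite expr0n /= addr0 subr0 mul1r; lra.
have /andP[a0 a1] := sqrt_bound01 n; have /andP[b0 b1] := sqrt_bound01 n.+1.
rewrite sqrt_iterS [sqrt_iter n.+1 x in X in nrm (_ - X)]sqrt_iterS -scalerBr nrmZ norm_half.
set A := sqrt_iter n.+1 in b0 b1 IH *; set B := sqrt_iter n in IH *.
have -> : Z x + A (A x) - (Z x + B (B x)) = A (A x - B x) + (A (B x) - B (B x)).
  by rewrite linearB/= opprD addrACA subrr add0r addrA subrK.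
have h1 := nrmD (A (A x - B x)) (A (B x) - B (B x)).
have h2 : nrm (A (A x - B x)) <= sqrt_bound n.+1 * nrm (A x - B x) by exact: sqrt_iter_le.
have h3 := IH (B x); have h4 := ler_wpM2l b0 (IH x).
have d0 : 0 <= sqrt_bound n.+1 - sqrt_bound n by rewrite /=; nra.
have h5 := ler_wpM2l d0 (sqrt_iter_le n x); rewrite -/B in h5.
rewrite [sqrt_bound n.+2]/= -/(sqrt_bound n.+1).
have h6 : sqrt_bound n.+1 * nrm x = (1 + sqrt_bound n ^+ 2) / 2 * nrm x by [].
move: (sqrt_bound n.+1) (sqrt_bound n) h1 h2 h3 h4 h5 h6 => a b *; lra.
Qed.

Lemma sqrt_iter_comm C : C ∘ T = T ∘ C -> forall n x, C (sqrt_iter n x) = sqrt_iter n (C x).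
Proof.
move=> CT; have CZ x : C (Z x) = Z (C x).
  by rewrite !ZE linearB/= -!bop_compE CT.
elim=> [|n IH] x; first by rewrite /= ?bop0E linear0.
by rewrite !sqrt_iterS linearZ/= linearD/= CZ !IH.
Qed.

Lemma sqrt_iter_selfadjoint n x y : rin (sqrt_iter n x) y = rin x (sqrt_iter n y).
Proof.
have TT := positive_selfadjoint Tpos.
elim: n x y => [|n IH] x y; first by rewrite /= ?bop0E /rin linear0l linear0r.
rewrite !sqrt_iterS rinZl rinZr rinDl rinDr !IH !ZE rinDl rinDr rinNl rinNr.
by rewrite (selfadjoint_rin x y TT).
Qed.

Lemma sqrt_iter_limit : exists2 L : 'L(H, H),
  forall x, tends (fun n => sqrt_iter n x) (L x) & forall x, nrm (L x) <= 1 * nrm x.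
Proof.
apply: (@bop_of_rel _ H H (fun x l => tends (fun n => sqrt_iter n x) l)).
- move=> x; have [n|n|l lu ul] := @telescope_cvg _ _ (fun n => sqrt_iter n x)
    (fun n => (1 - sqrt_bound n) * nrm x).
  + by have /andP[_ b1] := sqrt_bound01 n; rewrite mulr_ge0 ?subr_ge0 ?nrm_ge0.
  + by apply: le_trans (sqrt_iter_dist n x) _; lra.
  by exists l => //; have := lu 0%N; rewrite /= ?bop0E !subr0.
- by move=> x y y'; exact: tends_uniq.
- move=> a x x' y y' xy xy'; have := tends_add (tends_scale a xy) xy'.
  by congr tends; apply/funext => n; rewrite linearP.
Qed.

(** The limit L solves 2 L = 1 - T + L^2, that is (1 - L)^2 = T, and 1 - L is positive as L is a
    contraction. The commutation clause, inherited from the iterates, is what uniqueness of the root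
    rests on. *)
Lemma contraction_sqrt : exists Q, [/\ positive_op Q, Q ∘ Q = T &
  forall C, C ∘ T = T ∘ C -> C ∘ Q = Q ∘ C].
Proof.
have [L Lt L1] := sqrt_iter_limit.
have Lself x y : rin (L x) y = rin x (L y).
  apply/eqP; rewrite -subr_eq0 -normr_eq0 eq_le normr_ge0 andbT.
  apply: (@ler_addgt0M _ _ _ (nrm y + nrm x)) => e e0; rewrite add0r mulrDr.
  have [N1 h1] := Lt x e e0; have [N2 h2] := Lt y e e0.
  have := h1 _ (leq_maxl N1 N2); have := h2 _ (leq_maxr N1 N2).
  set n := maxn _ _ => {}h2 {}h1.
  have -> : rin (L x) y - rin x (L y) =
      rin (L x - sqrt_iter n x) y - rin x (L y - sqrt_iter n y).
    by rewrite rinDl rinDr rinNl rinNr sqrt_iter_selfadjoint; ring.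
  have k1 := ler_wpM2r (nrm_ge0 y) (ltW h1); have k2 := ler_wpM2r (nrm_ge0 x) (ltW h2).
  have r1 := rin_ler (L x - sqrt_iter n x) y.
  have r2 := rin_ler (- (L x - sqrt_iter n x)) y.
  have r3 := rin_ler (L y - sqrt_iter n y) x.
  have r4 := rin_ler (- (L y - sqrt_iter n y)) x.
  rewrite nrmN rinNl in r2; rewrite nrmN rinNl in r4.
  by rewrite (rinC x) ler_norml; apply/andP; split; lra.
(* The square passes to the pointwise limit because every iterate is a contraction. *)
have LE x : L x = 2^-1%:C%C *: (Z x + L (L x)).
  apply: tends_uniq (tends_shift (Lt x)) _.
  apply: tends_scale; apply: tends_add; first exact: tends_cst.
  move=> e e0.
  have [|N1 h1] := Lt (L x) (e / 2); first by rewrite divr_gt0.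
  have [|N2 h2] := Lt x (e / 2); first by rewrite divr_gt0.
  exists (maxn N1 N2) => n; rewrite geq_max => /andP[/h1 {}h1 /h2 {}h2].
  apply: le_lt_trans (nrm_dist _ (sqrt_iter n (L x)) _) _.
  rewrite -linearB /=; have := sqrt_iter_le n (L x - sqrt_iter n x).
  have /andP[b0 b1] := sqrt_bound01 n.
  have := ler_wpM2r (nrm_ge0 (L x - sqrt_iter n x)) b1; rewrite mul1r; lra.
exists (bop_id - L); split.
- apply: rin_positive.
    by apply: rin_adjoint_uniq => x y; rewrite !bopB rinDl rinDr rinNl rinNr Lself.
  move=> x; rewrite bopB rinDl rinNl rin_nrm; have := rin_ler (L x) x.
  have := ler_wpM2r (nrm_ge0 x) (L1 x); rewrite mul1r; lra.
- apply: bopP => x; rewrite bop_compE !bopB (linearB L)/=.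
  have := LE x; rewrite ZE => h.
  have {}h : L x + L x = x - T x + L (L x).
    have e : 2^-1 + 2^-1 = 1 :> R by field.
    by rewrite {1 2}h -scalerDl -rmorphD e rmorph1 scale1r.
  by rewrite -addrA -opprD addrA h addrK opprB addrC subrK.
- move=> C CT; apply: bopP => x; rewrite !bop_compE !bopB linearB/=; congr (_ - _).
  apply: tends_uniq (tends_bop C (Lt x)) _.
  have := Lt (C x); congr tends; apply/funext => n.
  by rewrite sqrt_iter_comm.
Qed.

End Contraction.
End SquareRoot.

Section SquareRootTheory.
Variables (R : realType) (H : hilbertType R).
Implicit Types T P Q C : 'L(H, H).

Lemma positive_scale (r : R) T : 0 <= r -> positive_op T -> positive_op (r%:C%C *: T).
Proof. by move=> r0 Tp x; rewrite bopZ linearZl_LR mulr_ge0 ?Tp ?lecR. Qed.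

Lemma sqrt_exists T : positive_op T -> exists Q, [/\ positive_op Q, Q ∘ Q = T &
  forall C, C ∘ T = T ∘ C -> C ∘ Q = Q ∘ C].
Proof.
move=> Tp; have [M M0 TM] := bop_nrm T.
have M1 : 0 < M + 1 by rewrite ltr_wpDl.
have Mi : 0 <= (M + 1)^-1 by rewrite invr_ge0 ltW.
pose s := Num.sqrt (M + 1).
have [|x|Q [Qp QQ QC]] := @contraction_sqrt _ _ ((M + 1)^-1%:C%C *: T).
- exact: positive_scale.
- rewrite bopZ nrmZ ger0_norm// mulrC ler_pdivrMr//; apply: le_trans (TM x) _.
  by rewrite mulrC ler_wpM2l ?nrm_ge0// lerDl.
exists (s%:C%C *: Q); split.
- by apply: positive_scale => //; exact: sqrtr_ge0.
- apply: bopP => x; rewrite bop_compE !bopZ linearZ/= scalerA -rmorphM -expr2.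
  rewrite sqr_sqrtr ?ltW// -bop_compE QQ bopZ scalerA -rmorphM divff ?gt_eqF//.
  by rewrite scale1r.
- move=> C CT; have {}QC : C ∘ Q = Q ∘ C.
    apply: QC; apply: bopP => x; rewrite !bop_compE !bopZ linearZ/=.
    by rewrite -!bop_compE CT.
  apply: bopP => x; rewrite !bop_compE !bopZ linearZ/=.
  by rewrite -!bop_compE QC.
Qed.

(** Each root A is compared with the constructed Q0, which commutes with A because A commutes with
    T. For y = (A - Q0) x one gets (A + Q0) y = 0; positivity gives A y = Q0 y = 0, hence <y, y> =
    <x, (A - Q0) y> = 0. *)
Lemma sqrt_uniq T P Q : positive_op P -> positive_op Q -> P ∘ P = T -> Q ∘ Q = T -> P = Q.
Proof.
move=> Pp Qp PP QQ.
have Tp : positive_op T.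
  by move=> x; rewrite -PP bop_compE adjointP (positive_selfadjoint Pp) inner_nrm lecR sqr_ge0.
have [Q0 [Q0p QQ0 Q0C]] := sqrt_exists Tp.
suff uniq A : positive_op A -> A ∘ A = T -> A = Q0 by rewrite (uniq P Pp PP) (uniq Q Qp QQ).
move=> Ap AA; have AQ : A ∘ Q0 = Q0 ∘ A.
  by apply: Q0C; rewrite -AA; apply: bopP.
apply: bopP => x; apply/eqP; rewrite -subr_eq0; apply/eqP; set y := A x - Q0 x.
have y0 : A y + Q0 y = 0.
  rewrite /y !linearB/= -!bop_compE AA QQ0 AQ addrA subrK subrr //.
have [Ay Qy] : rin (A y) y = 0 /\ rin (Q0 y) y = 0.
  have := positive_rin y Ap; have := positive_rin y Q0p.
  have : rin (A y) y + rin (Q0 y) y = 0 by rewrite -rinDl y0 /rin linear0l.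
  by split; lra.
apply: nrm_eq0; apply/eqP; rewrite -sqrf_eq0 -rin_nrm {1}/y rinDl rinNl.
rewrite !selfadjoint_rin ?positive_selfadjoint//.
by rewrite (positive_eq0 Ap Ay) (positive_eq0 Q0p Qy) subrr.
Qed.

Lemma sqrt_opE T Q : positive_op Q -> Q ∘ Q = T -> sqrt_op T = Q.
Proof.
move=> Qp QQ; rewrite /sqrt_op; case: xgetP => [P _ [Pp PP]|/(_ Q) []//].
exact: sqrt_uniq PP QQ.
Qed.

Lemma sqrt_opP T : positive_op T -> positive_op (sqrt_op T) /\ sqrt_op T ∘ sqrt_op T = T.
Proof. by move=> /sqrt_exists[Q [Qp QQ _]]; rewrite (sqrt_opE Qp QQ). Qed.

End SquareRootTheory.

Lemma eq_rin (R : realType) (H : hilbertType R) (x y : H) :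
  (forall z, rin z x = rin z y) -> x = y.
Proof.
move=> xy; apply/eqP; rewrite -subr_eq0; apply/eqP/nrm_eq0/eqP.
by rewrite -sqrf_eq0 -rin_nrm rinDr rinNr xy subrr.
Qed.

(** * Polar decomposition and absolute values of adjoints *)

Section Polar.
Variables (R : realType) (H K : hilbertType R) (A : 'L(H, K)).

Lemma positive_adjoint_comp : positive_op (adjoint A ∘ A).
Proof. by move=> x; rewrite bop_compE inner_adjointl inner_nrm lecR sqr_ge0. Qed.

Lemma abs_opP : positive_op (abs_op A) /\ abs_op A ∘ abs_op A = adjoint A ∘ A.
Proof. exact: sqrt_opP positive_adjoint_comp. Qed.

Lemma nrm_abs_op x : nrm (abs_op A x) = nrm (A x).
Proof.
have [Qp QQ] := abs_opP.
apply/eqP; rewrite -(@eqrXn2 _ 2) ?nrm_ge0// -!rin_nrm.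
rewrite selfadjoint_rin ?positive_selfadjoint// -bop_compE QQ bop_compE.
by rewrite -rin_adjoint.
Qed.

(** U is the adjoint of the reduced solution D of |A| D = A^*. It preserves norms on the range of
    |A|, hence on its closure, which contains the complement of the nullspace of A; it kills that
    nullspace because D takes values orthogonal to it. *)
Lemma polar_exists : exists U : 'L(H, K), [/\ A = U ∘ abs_op A,
  nullspace U = nullspace A & forall x, orth (nullspace U) x -> `|U x| = `|x|].
Proof.
have [Qp QQ] := abs_opP; have Qs := positive_selfadjoint Qp.
have [|D [QD Do]] := @majorized_reduced_solution _ K H H (abs_op A) (adjoint A) 1 ler01.
  by move=> g; rewrite adjointK Qs nrm_abs_op mul1r.
pose U := adjoint D.
have AU : A = U ∘ abs_op A.
  by rewrite -[LHS]adjointK -QD adjoint_comp Qs.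
have nQ x : nullspace (abs_op A) x <-> nullspace A x.
  split; rewrite /nullspace/= => h; apply: nrm_eq0.
    by rewrite -nrm_abs_op h nrm0.
  by rewrite nrm_abs_op h nrm0.
have iso x : orth (nullspace A) x -> nrm (U x) = nrm x.
  move=> Ax; have /closure_nrmP Qx : closure (range (abs_op A)) x.
    rewrite -{1}Qs; apply: orth_nullspace_closure => z /nQ; exact: Ax.
  have [M M0 UM] := bop_nrm U.
  apply/eqP; rewrite -subr_eq0 -normr_eq0 eq_le normr_ge0 andbT.
  apply: (@ler_addgt0M _ _ _ (M + 1)) => e /Qx[_ [h _ <-]] xh; rewrite add0r.
  have k1 : nrm (U (abs_op A h)) = nrm (abs_op A h) by rewrite -bop_compE -AU nrm_abs_op.
  have k2 : nrm (U x - U (abs_op A h)) <= M * nrm (x - abs_op A h).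
    by have := UM (x - abs_op A h); rewrite linearB.
  have k3 := ler_wpM2l M0 (ltW xh).
  have k4 := nrm_dist (U x) (U (abs_op A h)) 0; have k5 := nrm_dist x (abs_op A h) 0.
  have k6 := nrm_dist (U (abs_op A h)) (U x) 0; have k7 := nrm_dist (abs_op A h) x 0.
  rewrite !subr0 in k4 k5 k6 k7; rewrite nrmB in k6; rewrite nrmB in k7.
  by rewrite ler_norml; apply/andP; split; lra.
have nU x : nullspace A x -> U x = 0.
  move=> /nQ Ax; apply: inner_self_eq0; rewrite inner_adjointl.
  by apply: orthC; apply: Do Ax; exists (U x).
have UA : nullspace U = nullspace A.
  apply/seteqP; split=> x Ux; last exact: nU.
  pose z := x - proj (closure_range (adjoint A)) x.
  have Az : A z = 0.
    apply: orth_range_adjoint => y; apply: orthC; apply: proj_orth.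
    by apply: subset_closure; exists y.
  pose p := proj (closure_range (adjoint A)) x.
  have po : orth (nullspace A) p.
    have pc : closure (range (adjoint A)) p by exact: (proj_in (closure_range (adjoint A)) x).
    move=> y Ay; apply: orth_closure pc => _ [g _ <-].
    by rewrite inner_adjointl Ay linear0r.
  have p0 : p = 0.
    have pE : p = x - z by rewrite /z opprB addrC subrK.
    have Up : U p = U x - U z by rewrite pE; exact: linearB.
    by apply: nrm_eq0; rewrite -iso// Up Ux nU// subrr nrm0.
  by move: Az; rewrite /z -/p p0 subr0.
exists U; split=> // x; rewrite UA => /iso; by rewrite !nrmE => ->.
Qed.

Lemma polar_opP : [/\ A = polar_op A ∘ abs_op A,
  nullspace (polar_op A) = nullspace A &
  forall x, orth (nullspace (polar_op A)) x -> `|polar_op A x| = `|x|].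
Proof.
rewrite /polar_op; case: xgetP => [U _ //|/(_ _)].
by have [U UP] := polar_exists => /(_ U).
Qed.

Let U := polar_op A.
Let W := sqrt_op (abs_op A).

Lemma sqrt_abs_opP : [/\ positive_op W, W ∘ W = abs_op A & adjoint W = W].
Proof.
have [Wp WW] := sqrt_opP abs_opP.1.
by split=> //; exact: positive_selfadjoint.
Qed.

Lemma nullspace_sqrt_abs_op : nullspace W = nullspace A.
Proof.
have [Wp WW Ws] := sqrt_abs_opP.
apply/seteqP; split => x; rewrite /nullspace/= => h; apply: nrm_eq0.
  by rewrite -nrm_abs_op -WW bop_compE h linear0 nrm0.
have h' : abs_op A x = 0 by apply: nrm_eq0; rewrite nrm_abs_op h nrm0.
apply/eqP; rewrite -sqrf_eq0 -rin_nrm rin_adjoint Ws -bop_compE WW h'.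
by rewrite /rin linear0r.
Qed.

Lemma sqrt_abs_op_orth x : orth (nullspace A) (W x).
Proof.
have [Wp WW Ws] := sqrt_abs_opP; rewrite -nullspace_sqrt_abs_op.
by move=> z Wz; rewrite adjointP Ws Wz linear0r.
Qed.

(** Norm preservation polarises to preservation of real pairings. The test vector w may be replaced
    by its part p orthogonal to the nullspace, since U kills the rest. *)
Lemma polar_isometry z : orth (nullspace A) z -> adjoint U (U z) = z.
Proof.
move=> Az; have [AU UA iso] := polar_opP; rewrite -/U in AU UA iso.
have nrmU x : orth (nullspace A) x -> nrm (U x) = nrm x.
  by rewrite -UA /nrm => /iso ->.
apply: eq_rin => w; rewrite -rin_adjoint.
pose p := proj (closure_range (adjoint A)) w.
have Aq : nullspace A (w - p).
  apply: orth_range_adjoint => y; apply: orthC; apply: proj_orth.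
  by apply: subset_closure; exists y.
have Ap : orth (nullspace A) p.
  have pc : closure (range (adjoint A)) p by exact: (proj_in (closure_range (adjoint A)) w).
  move=> y Ay; apply: orth_closure pc => _ [g _ <-].
  by rewrite inner_adjointl Ay linear0r.
have -> : rin w z = rin p z.
  by rewrite -(subrK p w) rinDl rinC /rin (Az _ Aq) add0r.
have -> : U w = U p.
  have e : U (w - p) = U w - U p by exact: linearB.
  by move: Aq; rewrite -UA /nullspace/= e => /eqP; rewrite subr_eq0 => /eqP.
have := nrmU (p + z); rewrite linearD/= => h; have {}h := h _.
have : nrm (U p + U z) ^+ 2 = nrm (p + z) ^+ 2.
  by rewrite h// -[p]scale1r; exact: orthP.
by rewrite !nrmD2 !nrmU// !mulr2n; lra.
Qed.

Lemma sqrt_abs_op_polar x : W (adjoint U (U x)) = W x.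
Proof.
have [Wp WW Ws] := sqrt_abs_opP.
apply: eq_rin => w; rewrite -{1 2}Ws -!rin_adjoint rinC rin_adjoint.
by rewrite polar_isometry 1?rinC//; exact: sqrt_abs_op_orth.
Qed.

Lemma abs_op_polar x : abs_op A (adjoint U x) = adjoint A x.
Proof.
have [AU _ _] := polar_opP; rewrite -/U in AU.
by rewrite {2}AU adjoint_comp (positive_selfadjoint abs_opP.1).
Qed.

(** The right-hand side is positive and its square is A A^*, because U^* U fixes the range of |A|;
    uniqueness of the root concludes. *)
Lemma abs_op_adjoint : abs_op (adjoint A) = U ∘ abs_op A ∘ adjoint U.
Proof.
have [AU _ _] := polar_opP; rewrite -/U in AU.
have [Wp WW Ws] := sqrt_abs_opP.
apply: sqrt_opE.
  by move=> x; rewrite !bop_compE adjointP; exact: abs_opP.1.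
apply: bopP => x; rewrite !bop_compE polar_isometry; last first.
  by rewrite -WW; exact: sqrt_abs_op_orth.
by rewrite -(bop_compE U (abs_op A)) -AU abs_op_polar adjointK.
Qed.

Lemma sqrt_abs_op_adjoint : sqrt_op (abs_op (adjoint A)) = U ∘ W ∘ adjoint U.
Proof.
have [Wp WW Ws] := sqrt_abs_opP.
apply: sqrt_opE.
  by move=> x; rewrite !bop_compE adjointP; exact: Wp.
rewrite abs_op_adjoint; apply: bopP => x; rewrite !bop_compE polar_isometry.
  by rewrite -WW.
exact: sqrt_abs_op_orth.
Qed.

(** Turns the coefficient in the equation defining E into U W, so that E and F are both expressed
    through the single root W. *)
Lemma sqrt_abs_op_intertwine : sqrt_op (abs_op (adjoint A)) ∘ U = U ∘ W.
Proof.
by apply: bopP => x; rewrite sqrt_abs_op_adjoint !bop_compE sqrt_abs_op_polar.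
Qed.

End Polar.

(** * Bilateral shorted operators *)

Section Complementable.
Variables (R : realType) (H1 H2 : hilbertType R).

Lemma block_val (S : csubspace H1) (T : csubspace H2) (A : 'L(H1, H2)) s :
  val (block S T A s) = proj T (A (val s)).
Proof. by []. Qed.

Lemma projB (S : csubspace H1) x y : proj S (x - y) = proj S x - proj S y.
Proof. by rewrite addrC -scaleN1r proj_linear scaleN1r addrC. Qed.

Lemma proj_inner (S : csubspace H1) x y : csubspace_set S y -> '[proj S x, y] = '[x, y].
Proof.
move=> Sy; apply/eqP; rewrite eq_sym -subr_eq0 -linearBl/=; apply/eqP.
exact: proj_orth.
Qed.

Lemma proj_complement_eq0 (S : csubspace H1) x : proj (S^⊥) x = 0 <-> csubspace_set S x.
Proof.
split=> [x0|Sx].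
  by apply: orthK; have := @proj_orth _ _ (S^⊥) x; rewrite x0 subr0.
by apply: proj_eq0 => y Sy; apply: orthC; exact: Sy.
Qed.

End Complementable.

Lemma adjoint_block (R : realType) (H1 H2 : hilbertType R)
    (S : csubspace H1) (T : csubspace H2) (A : 'L(H1, H2)) :
  adjoint (block S T A) = block T S (adjoint A).
Proof.
apply: adjoint_uniq => s t; rewrite !csub_innerE !block_val.
rewrite proj_inner ?adjointP; last exact: csub_in.
by rewrite innerC [RHS]innerC proj_inner //; exact: csub_in.
Qed.

(* Block-free form of the inclusion of the range of A21 in that of A22. *)
Definition liftable (R : realType) (H1 H2 : hilbertType R)
    (S : csubspace H1) (T : csubspace H2) (A : 'L(H1, H2)) :=
  forall x, csubspace_set S x ->
    exists2 y, orth S y & csubspace_set T (A (x - y)).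

Section Shorted.
Variables (R : realType) (H1 H2 : hilbertType R).
Implicit Types (S : csubspace H1) (T : csubspace H2) (A : 'L(H1, H2)).

Lemma range_block_liftable S T A :
  range (block S (T^⊥) A) `<=` range (block (S^⊥) (T^⊥) A) <-> liftable S T A.
Proof.
split=> [rA x Sx|lA _ [s _ <-]].
  have [y _ yx] := rA _ (ex_intro2 _ _ (csub_of Sx) I erefl).
  exists (val y); first exact: (csub_in y).
  apply/proj_complement_eq0; have := congr1 val yx; rewrite !block_val => {}yx.
  by rewrite (linearB A)/= projB yx subrr.
have [y Sy Ty] := lA _ (csub_in s).
exists (@csub_of _ _ (S^⊥) y Sy) => //; apply: val_inj; rewrite !block_val /=.
apply/eqP; rewrite eq_sym -subr_eq0 -projB -(linearB A)/=.
by apply/eqP/proj_complement_eq0.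
Qed.

End Shorted.

Section ShortedFormula.
Variables (R : realType) (H1 H2 : hilbertType R).
Variables (S : csubspace H1) (T : csubspace H2) (A : 'L(H1, H2)).

(** The adjoint of a block is a block of the adjoint, so the second inclusion is the first one for
    A^* with S and T exchanged. *)
Lemma complementableP :
  complementable S T A <-> liftable S T A /\ liftable T S (adjoint A).
Proof. by rewrite /complementable !adjoint_block !range_block_liftable. Qed.

Let A12 := block (S^⊥) T A.
Let A21 := block S (T^⊥) A.
Let A22 := block (S^⊥) (T^⊥) A.

(* With W = |A22|^(1/2), the operators of the definition are E = W X0 and
   F = W U^* Y0, where A12^* = A22^* Y0, so that F^* E = Y0^* A22 X0 = A12 X0. *)
Lemma shorted_reduced_solution X0 : complementable S T A ->
  is_reduced_solution A22 A21 X0 -> shorted S T A = corner (block S T A - A12 ∘ X0).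
Proof.
move=> [_ cA12] [X0E X0o].
have [Y0 [Y0E Y0o]] := range_subset_reduced_solution cA12.
rewrite -/A12 -/A22 in Y0E.
have [AU UA _] := polar_opP A22; have [Wp WW Ws] := sqrt_abs_opP A22.
set U := polar_op A22 in AU UA *; set W := sqrt_op (abs_op A22) in Wp WW Ws *.
have EE : reduced_solution (sqrt_op (abs_op (adjoint A22)) ∘ U) A21 = W ∘ X0.
  rewrite sqrt_abs_op_intertwine -/U -/W; apply: reduced_solutionE; split.
    by rewrite -X0E [in RHS]AU -WW; apply: bopP.
  (* U is injective on the range of W, so U W and W have the same nullspace, to which W X0 is
     orthogonal. *)
  move=> _ [s _ <-] z Uz; apply: sqrt_abs_op_orth.
  rewrite -nullspace_sqrt_abs_op /nullspace/= -/W.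
  by rewrite -[LHS](polar_isometry (sqrt_abs_op_orth _)) -/W -/U [U (W z)]Uz linear0.
have FF : reduced_solution W (adjoint A12) = W ∘ adjoint U ∘ Y0.
  apply: reduced_solutionE; split.
    by rewrite -Y0E; apply: bopP => t; rewrite !bop_compE -(bop_compE W W) WW abs_op_polar.
  by move=> _ [t _ <-]; rewrite nullspace_sqrt_abs_op; exact: sqrt_abs_op_orth.
rewrite /shorted; cbv zeta; rewrite EE FF.
congr (corner (_ - _)); apply: bopP => s; apply: eq_inner => t.
rewrite bop_compE -adjointP !bop_compE (adjointP W) Ws -(bop_compE W W) WW.
rewrite (inner_adjointl U) -(bop_compE U) -AU.
by rewrite -(inner_adjointl A22) -(bop_compE _ Y0) Y0E inner_adjointl.
Qed.

Lemma shorted_solution (cA : complementable S T A) x :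
  exists y, [/\ orth S y, csubspace_set T (A (proj S x - y)) &
    shorted S T A x = A (proj S x - y)].
Proof.
have [X0 X0P] := range_subset_reduced_solution cA.1.
rewrite (shorted_reduced_solution cA X0P).
exists (val (X0 (projection S x))).
have Ty : csubspace_set T (A (proj S x - val (X0 (projection S x)))).
  apply/proj_complement_eq0; 
  have := congr1 (fun D : 'L(csub S, csub (T^⊥)) => val (D (projection S x))) X0P.1.
  rewrite bop_compE !block_val => yx.
  by rewrite (linearB A)/= projB yx subrr.
split=> //; first exact: (csub_in (X0 (projection S x))).
rewrite -[RHS](proj_id Ty) (linearB A)/= projB.
by rewrite /= scaleN1r.
Qed.

(** Two lifts of the same vector give values differing by some t = A (y - y') in T. Lifting t
    through A^* yields w orthogonal to T with A^* (t - w) in S, whence <t, t> = <t, t - w> = <y -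
    y', A^* (t - w)> = 0. *)
Lemma shortedE (cA : complementable S T A) x y :
  orth S y -> csubspace_set T (A (proj S x - y)) -> shorted S T A x = A (proj S x - y).
Proof.
move=> Sy Ty; have [y' [Sy' Ty' ->]] := shorted_solution cA x.
have [_ lA] := (complementableP).1 cA.
apply/eqP; rewrite -subr_eq0; apply/eqP; set t := _ - _.
have Tt : csubspace_set T t by exact: csubspaceB.
have [w Tw Aw] := lA _ Tt.
have tE : t = A (y - y').
  by rewrite /t !(linearB A)/= opprB addrC addrA subrK.
apply: inner_self_eq0.
clearbody t.
have tw : '[t, w] = 0 by apply: orthC; exact: Tw.
have -> : '[t, t] = '[t, t - w] by rewrite linearBr/= tw subr0.
rewrite {1}tE adjointP.
have Syy : orth S (y - y') by apply: (@csubspaceB _ _ (S^⊥)).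
exact: Syy.
Qed.

End ShortedFormula.

(** * Parallel sums *)

Section ParallelSum.
Variables (R : realType) (H1 H2 : hilbertType R).
Implicit Types A B : 'L(H1, H2).

Lemma orth_dsum_fst (H : hilbertType R) (y : H) : orth (dsum_fst H H) ((0, y) : H ⊕ H).
Proof.
move=> [z1 z2] z0; have {z0}-> : z2 = 0 by exact: z0.
by rewrite dsum_innerE/= linear0l linear0r addr0.
Qed.

Lemma proj_dsum_fst (H : hilbertType R) (x : H ⊕ H) : proj (dsum_fst H H) x = (x.1, 0).
Proof.
apply: proj_uniq => //; have -> : x - (x.1, 0) = (0, x.2).
  by case: x => x1 x2; congr pair; rewrite /= ?subrr ?subr0.
exact: orth_dsum_fst.
Qed.

Lemma adjoint_opmatrix A B C D :
  adjoint (opmatrix A B C D) =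
  opmatrix (adjoint A) (adjoint C) (adjoint B) (adjoint D).
Proof.
apply: adjoint_uniq => x y; rewrite !dsum_innerE /=.
by rewrite !linearDl !linearDr /= !adjointP addrACA.
Qed.

Definition parallel_matrix A B := opmatrix A A A (A + B).

(** The second row at (x, -y) is A x - (A + B) y = 0: any such y provides a lift (0, y) of (x,
    0). *)
Lemma parallel_matrixE A B x y : (A + B) y = A x ->
  parallel_matrix A B ((x, 0) - (0, y) : H1 ⊕ H1) = (A (x - y), 0).
Proof.
move=> xy; have -> : (x, 0) - (0, y) = (x, - y) :> H1 ⊕ H1.
  by congr pair; rewrite /= ?subr0 ?sub0r.
rewrite (linearB A)/=; congr pair; first by rewrite /= linearN.
by rewrite -[LHS]/(A x + (A + B) (- y)) (linearN (A + B))/= -xy subrr.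
Qed.

End ParallelSum.

Lemma range_liftable (R : realType) (H1 H2 : hilbertType R) (A B : 'L(H1, H2)) :
  range A `<=` range (A + B) ->
  liftable (dsum_fst H1 H1) (dsum_fst H2 H2) (parallel_matrix A B).
Proof.
move=> AB [x1 x2] x0; have {x0}-> : x2 = 0 by exact: x0.
have [y _ yx] := AB _ (ex_intro2 _ _ x1 I erefl).
exists (0, y); first exact: orth_dsum_fst.
by rewrite parallel_matrixE.
Qed.

Section ParallelSumFormula.
Variables (R : realType) (H1 H2 : hilbertType R) (A B : 'L(H1, H2)).
Hypothesis AB : parallel_summable A B.

Let S1 := dsum_fst H1 H1.
Let S2 := dsum_fst H2 H2.
Let M := parallel_matrix A B.

Lemma parallel_matrix_complementable : complementable S1 S2 M.
Proof.
apply/complementableP; split; first exact: range_liftable AB.1.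
by rewrite /M /parallel_matrix adjoint_opmatrix adjointD; exact: range_liftable AB.2.
Qed.

Lemma shorted_parallel_matrix (x : H1 ⊕ H1) y : (A + B) y = A x.1 ->
  shorted S1 S2 M x = (A (x.1 - y), 0).
Proof.
move=> xy; rewrite (@shortedE _ _ _ S1 S2 M parallel_matrix_complementable x (0, y)).
- by rewrite proj_dsum_fst parallel_matrixE.
- exact: orth_dsum_fst.
- by rewrite proj_dsum_fst parallel_matrixE.
Qed.

(** Supplies the operator whose existence lets [parallel_sum] differ from the default of [xget]. *)
Lemma parallel_sum_subproof :
  let f (x : H1) := (shorted S1 S2 M (x, 0)).1 in
  linear f /\ exists c : R, forall x, `|f x| <= c%:C%C * `|x|.
Proof.
split=> [a x y|].
  have -> : ((a *: x + y, 0) : H1 ⊕ H1) = a *: (x, 0) + (y, 0).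
    by congr pair; rewrite /= scaler0 addr0.
  by rewrite linearP.
have [c c0 cM] := bop_boundP (shorted S1 S2 M); exists c => x.
apply: le_trans (dsum_norm_fst _) _; apply: le_trans (cM _) _.
rewrite ler_wpM2l ?lecR//; apply: le_trans (dsum_norm_le _) _.
by rewrite /= normr0 addr0.
Qed.

Lemma parallel_sumE x y : (A + B) y = A x -> parallel_sum A B x = A (x - y).
Proof.
move=> xy; rewrite /parallel_sum; case: xgetP => [C _ /= CM|].
  have := congr1 (fun D : 'L(H1 ⊕ H1, H2 ⊕ H2) => (D ((x, 0) : H1 ⊕ H1)).1) CM.
  by rewrite (@shorted_parallel_matrix (x, 0) y)//= addr0.
move/(_ (BOp parallel_sum_subproof.1 parallel_sum_subproof.2)) => [].
apply: bopP => -[x1 x2].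
have [y1 _ yx] := AB.1 _ (ex_intro2 _ _ x1 I erefl).
rewrite (@shorted_parallel_matrix (x1, x2) y1)//.
rewrite -[LHS]/(((shorted S1 S2 M (x1, 0)).1 + 0, 0 + 0) : H2 ⊕ H2).
by rewrite (@shorted_parallel_matrix (x1, 0) y1)// !addr0.
Qed.

End ParallelSumFormula.

Lemma opnorm_bound (R : realType) (H1 H2 : hilbertType R) (A : 'L(H1, H2)) (c : R) :
  0 <= c -> (forall x, nrm (A x) <= c * nrm x) -> 0 <= opnorm A <= c.
Proof.
move=> c0 Ac; pose E := [set complex.Re `|A x| | x in [set x : H1 | `|x| <= 1]].
have E0 : E 0 by exists 0; rewrite /= ?normr0// linear0 normr0.
have Ec : ubound E c.
  move=> _ [x /= x1 <-]; apply: le_trans (Ac x) _.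
  by rewrite -[leRHS]mulr1 ler_wpM2l// -lecR -nrmE.
rewrite /opnorm -/E; apply/andP; split; first by apply: ub_le_sup => //; exists c.
by apply: ge_sup => //; exists 0.
Qed.

(** * Perturbation by large multiples of B *)

Section Perturbation.
Variables (R : realType) (H1 H2 : hilbertType R).
Variables (S : csubspace H1) (T : csubspace H2) (A B : 'L(H1, H2)).
Hypotheses (cA : complementable S T A) (rB : range B = T) (rB' : range (adjoint B) = S).

Let K := shorted S T A.

Lemma shorted_in x : csubspace_set T (K x).
Proof. by have [y [_ Ty ->]] := shorted_solution cA x. Qed.

(** The inclusion of T has its range inside that of B, so its adjoint is majorized by B^*; and |t|
    is at most the norm of that adjoint at t for t in T. *)
Lemma adjoint_bounded_below : exists2 c : R, 0 <= c &
  forall t, csubspace_set T t -> nrm t <= c * nrm (adjoint B t).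
Proof.
have [|c c0 cB] := @range_subset_majorized _ _ _ _ B (inclusion T).
  by rewrite rB => _ [t _ <-]; exact: csub_in.
exists c => // t Tt; apply: le_trans (cB t).
have [->|t0] := eqVneq (nrm t) 0; first exact: nrm_ge0.
rewrite -(@ler_pM2l _ (nrm t)) ?lt0r ?t0 ?nrm_ge0// -expr2 -rin_nrm.
have := rin_ler (csub_of Tt) (adjoint (inclusion T) t).
by rewrite -rin_adjoint /nrm csub_normE.
Qed.

Lemma vanish_orth x : orth S x -> B x = 0.
Proof.
move=> Sx; apply: orth_range_adjoint => y; apply: orthC; apply: Sx.
by rewrite -rB'; exists y.
Qed.

Lemma perturbation : exists c M : R, [/\ 0 <= c, 0 <= M &
  forall n : nat, c * M < n%:R -> forall x, exists k y,
    [/\ (A + n%:R *: B) y = A x, A (x - y) = K x - K k &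
        nrm k <= c / (n%:R - c * M) * nrm (K x)]].
Proof.
have [c c0 cB] := adjoint_bounded_below.
have [M M0 MK] := bop_nrm (adjoint K).
exists c, M; split=> // n cMn x.
have d0 : 0 < n%:R - c * M by rewrite subr_gt0.
pose G := K + n%:R *: B.
have Gt t : adjoint G t = adjoint K t + n%:R *: adjoint B t.
  by rewrite /G adjointD adjointZ conjC_nat.
(* From |t| <= c |B^* t| and n |B^* t| <= |G^* t| + M |t| follows (n - c M) |t| <= c |G^* t|; this
   is the origin of the threshold c M. *)
have low t : csubspace_set T t -> nrm t <= c / (n%:R - c * M) * nrm (adjoint G t).
  move=> Tt; rewrite mulrAC ler_pdivlMr//.
  have h1 : n%:R * nrm (adjoint B t) <= nrm (adjoint G t) + M * nrm t.
    have := nrmD (adjoint G t) (- adjoint K t).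
    rewrite {1}Gt addrAC subrr add0r natr_real_complex nrmZ ger0_norm// nrmN.
    by have := MK t; lra.
  have h2 := ler_wpM2l (ler0n R n) (cB t Tt); have h3 := ler_wpM2l c0 h1.
  lra.
have [a v w|a v w||t|k [_ kE kx]] := @bounded_functional_rep _ (csub T) H1
    (fun t => adjoint G (val t)) (fun t => '[val t, K x]) (c / (n%:R - c * M) * nrm (K x)).
- by rewrite csub_val_linear linearP.
- by rewrite csub_val_linear linearDl linearZl_LR.
- by rewrite mulr_ge0 ?nrm_ge0// divr_ge0// ltW.
- apply: le_trans (inner_nrm_le _ _) _; rewrite lecR mulrAC.
  by rewrite ler_wpM2r ?nrm_ge0// low//; exact: csub_in.
(* The representation tests G k - K x only against T, which suffices because this difference lies in
   T. *)
have Gk : K k + n%:R *: B k = K x.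
  apply/eqP; rewrite -subr_eq0; apply/eqP; apply: (@orth_disjoint _ _ T).
    apply: csubspaceB; last exact: shorted_in.
    apply: csubspaceD; first exact: shorted_in.
    by apply: csubspaceZ; rewrite -rB; exists k.
  move=> t Tt; apply: orthC; rewrite linearBr/=.
  by have := kE (csub_of Tt); rewrite /= inner_adjointl => ->; rewrite subrr.
have [w [Sw _ Kx]] := shorted_solution cA x; have [v [Sv _ Kk]] := shorted_solution cA k.
rewrite -/K in Kx Kk.
(* A maps the first summand to K k and the second to A x - K x, while B maps them to B k and 0. *)
pose y := (proj S k - v) + (x - (proj S x - w)).
have Ay : A y = K k + (A x - K x) by rewrite /y (linearD A)/= -Kk (linearB A)/= -Kx.
have Bproj z u : orth S u -> B (proj S z - u) = B z.
  move=> Su; apply/eqP; rewrite eq_sym -subr_eq0 -(linearB B)/=; apply/eqP/vanish_orth.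
  rewrite opprB addrCA addrC; apply: (@csubspaceD _ _ (S^⊥)) => //; exact: proj_orth.
have By : B y = B k.
  by rewrite /y (linearD B)/= Bproj// (linearB B)/= Bproj// subrr addr0.
exists k, y; split=> //; first by rewrite bopD bopZ Ay By addrAC Gk addrC subrK.
by rewrite (linearB A)/= Ay opprD addrCA opprB [A x + _]addrC subrK addrC.
Qed.

End Perturbation.

Lemma perturbation_range (R : realType) (H1 H2 : hilbertType R)
    (S : csubspace H1) (T : csubspace H2) (A B : 'L(H1, H2)) :
  complementable S T A -> range B = T -> range (adjoint B) = S ->
  exists N : nat, forall n, (N <= n)%N -> range A `<=` range (A + n%:R *: B).
Proof.
move=> cA rB rB'; have [c [M [c0 M0 cM]]] := perturbation cA rB rB'.
exists (Num.truncn (c * M)).+1 => n Nn _ [x _ <-].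
have [|k [y [yx _ _]]] := cM n _ x; last by exists y.
by apply: lt_le_trans (truncnS_gt _) _; rewrite ler_nat.
Qed.

Lemma complementable_adjoint (R : realType) (H1 H2 : hilbertType R)
    (S : csubspace H1) (T : csubspace H2) (A : 'L(H1, H2)) :
  complementable S T A -> complementable T S (adjoint A).
Proof. by move=> /complementableP[? ?]; apply/complementableP; rewrite adjointK. Qed.

Theorem proposition6p4 (R : realType) (H1 H2 : hilbertType R)
    (S : csubspace H1) (T : csubspace H2) (A B : 'L(H1, H2))
    (hA : complementable S T A)
    (hB : range B = T) (hBadj : range (adjoint B) = S) :
  exists n0 : nat,
    (forall n : nat, (n0 <= n)%N -> parallel_summable A (n%:R *: B)) /\
    (fun n : nat => opnorm (parallel_sum A (n%:R *: B) - shorted S T A))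
      @ \oo --> (0 : R).
Proof.
have [N1 hN1] := perturbation_range hA hB hBadj.
have [|N2 hN2] := perturbation_range (complementable_adjoint hA) hBadj.
  by rewrite adjointK.
have ps n : (maxn N1 N2 <= n)%N -> parallel_summable A (n%:R *: B).
  rewrite geq_max => /andP[n1 n2]; split; first exact: hN1.
  by rewrite adjointZ conjC_nat; exact: hN2.
exists (maxn N1 N2); split=> //.
have [c [M [c0 M0 cM]]] := perturbation hA hB hBadj.
set K := shorted S T A in cM *; have [L L0 LK] := bop_nrm K.
apply/cvgrPdist_le => e e0.
(* Beyond this index n - c M > L c L / e, which makes the bound L * c / (n - c M) * L at most e; one
   factor L bounds K k, the other K x. The first entries secure parallel summability. *)
pose N := maxn (maxn N1 N2) (Num.truncn (c * M + L * (c * L) / e)).+1.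
exists N => // n /=; rewrite geq_max => /andP[nN nt].
have nbig : c * M + L * (c * L) / e < n%:R.
  by apply: lt_le_trans (truncnS_gt _) _; rewrite ler_nat.
have q0 : 0 <= L * (c * L) / e by rewrite divr_ge0 ?mulr_ge0// ltW.
have cMn : c * M < n%:R by lra.
have d0 : 0 < n%:R - c * M by rewrite subr_gt0.
rewrite sub0r normrN.
have /andP[o0 oc] : 0 <= opnorm (parallel_sum A (n%:R *: B) - K)
    <= L * (c / (n%:R - c * M) * L).
  apply: opnorm_bound => [|x]; first by rewrite !mulr_ge0// ?invr_ge0 ltW.
  have [k [y [yx Axy kx]]] := cM n cMn x.
  rewrite bopB (parallel_sumE (ps n nN) yx) Axy addrAC subrr add0r nrmN.
  apply: le_trans (LK k) _; rewrite -mulrA ler_wpM2l//.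
  apply: le_trans kx _; rewrite -[leRHS]mulrA ler_wpM2l ?LK//.
  by rewrite divr_ge0// ltW.
rewrite ger0_norm//; apply: le_trans oc _.
have : L * (c * L) / e < n%:R - c * M by lra.
rewrite ltr_pdivrMr// => h; have -> : L * (c / (n%:R - c * M) * L) = L * (c * L) / (n%:R - c * M).
  by ring.
by rewrite ler_pdivrMr// [leRHS]mulrC ltW.
Qed.
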